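(* Let $n\ge 1$ and let $M\subset \mathbb{CP}^{n+1}$ be a stark hypersurface with shape operator $\mathsf{A}$. Then at every point $m\in M$ there is either a choice of standard basis $\mathfrak{B}$ of $T_mM$ such that $$[\mathsf{A}]_{\mathfrak{B}} = \begin{pmatrix} 0 & S & d \\ S & 0 & 0 \\ d^t & 0 & 0 \end{pmatrix},$$ where $S$ is an $n\times n$ symmetric matrix and $d$ is a nonzero (column) vector of length $n$, or a choice of split basis $\mathfrak{B}$ of $T_mM$, for some integers $k>0$, $\ell\ge 0$ with $k+\ell=n$, such that $$[\mathsf{A}]_{\mathfrak{B}} = \begin{pmatrix} P & Q & 0 & 0 & 0 \\ Q & -P & 0 & 0 & 0 \\ 0 & 0 & 0 & S & d \\ 0 & 0 & S & 0 & 0 \\ 0 & 0 & d^t & 0 & 0 \end{pmatrix},$$ where $P,Q$ are $k\times k$ symmetric matrices, $S$ is an $\ell\times\ell$ symmetric matrix and $d$ is a vector of length $\ell$.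
   Context: $\mathbb{CP}^{n+1}$ carries the Fubini–Study metric of constant holomorphic sectional curvature $4$, with complex structure $\mathsf{J}$. A hypersurface $M$ is a smooth real hypersurface (real dimension $2n+1$), with a (local) unit normal $\nu$. Its shape operator $\mathsf{A}$ is identified with the scalar second fundamental form $\mathsf{A}(X,Y)=\langle \nabla_XY,\nu\rangle$ on $TM$ ($\nabla$ the Levi-Civita connection of $\mathbb{CP}^{n+1}$). The structure vector is $W=-\mathsf{J}\nu$; $\mathcal{H}\subset TM$ is the holomorphic distribution, i.e. the orthogonal complement of $W$ in $TM$; $\widetilde{\mathsf{A}}$ is the restriction of the quadratic form $\mathsf{A}$ to $\mathcal{H}$; and $\varphi:TM\to TM$ is $\mathsf{J}$ followed by orthogonal projection to $TM$ (so $\varphi=\mathsf{J}$ on $\mathcal{H}$ and $\varphi W=0$). Austere: a submanifold of $\mathbb{CP}^{n+1}$ is austere if its normal bundle is special Lagrangian (for some constant phase) in $T\mathbb{CP}^{n+1}$ with Stenzel's Ricci-flat Kähler metric. For hypersurfaces it is a known theorem (Ionel–Ivey), which may be taken here as the definition, that $M$ is austere iff at each point $$\mathsf{A}^{(2j+1)}=\widetilde{\mathsf{A}}^{(2j-1)},\qquad j=0,\ldots,n,$$ where a superscript $(r)$ denotes the elementary symmetric function of degree $r$ in the eigenvalues of the matrix of the quadratic form in an orthonormal basis (interpreted as $0$ when $r$ is nonpositive or exceeds the size of the matrix). Stark: $M$ is stark if it is austere and $\widetilde{\mathsf{A}}(\mathsf{J}X,\mathsf{J}Y)=-\widetilde{\mathsf{A}}(X,Y)$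 for all $X,Y\in\mathcal{H}$ (equivalently $\widetilde{\mathsf{A}}(\mathsf{J}X,Y)=\widetilde{\mathsf{A}}(X,\mathsf{J}Y)$). A standard basis of $T_mM$ is an orthonormal basis $(\mathbf{e}_1,\ldots,\mathbf{e}_{2n+1})$ with $\mathbf{e}_{2n+1}=W$ and $\varphi(\mathbf{e}_j)=\mathbf{e}_{j+n}$ for $1\le j\le n$. A split basis, for $k+\ell=n$, is an orthonormal basis with $\mathbf{e}_{2n+1}=W$, $\varphi(\mathbf{e}_j)=\mathbf{e}_{j+k}$ for $1\le j\le k$, and $\varphi(\mathbf{e}_{2k+j})=\mathbf{e}_{2k+\ell+j}$ for $1\le j\le \ell$. $[\mathsf{A}]_{\mathfrak{B}}$ is the matrix of $\mathsf{A}$ in the basis $\mathfrak{B}$; blocks of size $0$ (when $\ell=0$) are omitted. *)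

(* Defs.v *)
(* MathComp and MathComp-Analysis. *)
From HB Require Import structures.
From mathcomp Require Import all_boot all_order all_algebra.
From mathcomp Require Import all_classical all_reals all_analysis.
Import Order.TTheory GRing.Theory Num.Theory numFieldNormedType.Exports.

Set Implicit Arguments.
Unset Strict Implicit.
Unset Printing Implicit Defensive.

Local Open Scope classical_set_scope.
Local Open Scope ring_scope.

(* Model of CP^{n+1}.  The vector x + i y of C^{n+2} is the row (x, y).  A
   point [z] of CP^{n+1} is represented by any vector z != 0 of its complex
   line, and a subset of CP^{n+1} by the cone over it in C^{n+2} \ {0}.
   T_[z] CP^{n+1} is identified, through the differential of z |-> [z], with
   the horizontal space at z, the orthogonal complement of z and J z.
   At unit vectors z the metric is then the Euclidean one: this is the metric
   making the Hopf fibration S^{2n+3} -> CP^{n+1} a Riemannian submersion,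
   i.e. the Fubini-Study metric of holomorphic sectional curvature 4. *)
Notation cspace R n := ('rV[R]_(n.+2 + n.+2)).

Section Projective.
Variables (R : realType) (n : nat).
Local Notation V := (cspace R n).
Implicit Types (z u v nu X Y : V) (M T : set V).

Definition dot u v : R := (u *m v^T) 0 0.

(* multiplication by i: J (x, y) = (- y, x) *)
Definition J u : V := u *m block_mx 0 1%:M (- 1%:M) 0.

Definition projective_set M : Prop :=
  (forall z, M z -> z != 0) /\
  (forall z (a b : R), M z -> (a, b) != (0, 0) -> M (a *: z + b *: J z)).

Definition horizontal z X : Prop := dot X z = 0 /\ dot X (J z) = 0.

Fixpoint Ck (k : nat) (U : set V) (f : V -> R) : Prop :=
  match k with
  | 0 => forall p, U p -> {for p, continuous f}
  | k'.+1 => (forall p, U p -> differentiable f p) /\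
             (forall v, Ck k' U ('D_v f))
  end.

Definition smooth (U : set V) (f : V -> R) : Prop := forall k, Ck k U f.

(* The projection from C^{n+2} \ {0} to CP^{n+1} being a surjective submersion,
   a subset of CP^{n+1} is a smooth (embedded) real hypersurface iff the cone
   over it is one in C^{n+2} \ {0}. *)
Definition hypersurface M : Prop :=
  projective_set M /\
  forall z, M z -> exists (U : set V) (F : V -> R),
    [/\ open U, U z, smooth U F,
        (forall p, U p -> (M p <-> F p = 0)) &
        (forall p, U p -> M p -> exists v, 'D_v F p != 0)].

(* T_[z] M, as a space of horizontal vectors: the horizontal velocities of
   curves in the cone *)
Definition tangent M z : set V :=
  [set X | horizontal z X /\
    exists c : R -> V, [/\ c 0 = z, is_derive (0 : R) 1 c X
                         & \forall t \near (0 : R), M (c t)]].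

Definition unit_normal M z nu : Prop :=
  [/\ horizontal z nu, dot nu nu = 1 &
      forall X, tangent M z X -> dot X nu = 0].

Definition W nu : V := - J nu.

(* The holomorphic distribution *)
Definition hol M z nu : set V :=
  [set X | tangent M z X /\ dot X (W nu) = 0].

(* For horizontal X, J X is horizontal, so that its projection to the tangent
   space of M only loses its component along nu. *)
Definition phi nu X : V := J X - dot (J X) nu *: nu.

(* The Levi-Civita connection of CP^{n+1} at a unit vector z: for a Riemannian
   submersion, the horizontal lift of the covariant derivative is the horizontal
   part of the covariant derivative of the horizontal lifts; the one of S^{2n+3}
   is the part tangent to the sphere of the directional derivative.  With X
   horizontal and Y any field of horizontal vectors (not necessarily J-linear
   along the complex lines), this is the pull-back of the Levi-Civita connection
   along z |-> [z]. *)
Definition nabla z X (Y : V -> V) : V :=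
  let D := 'D_X Y z in D - dot D z *: z - dot D (J z) *: J z.

(* A is the scalar second fundamental form (X, Y) |-> <nabla_X Y, nu> of M at
   [z], Y being extended to a field tangent to M.  The values of A outside the
   tangent space are irrelevant. *)
Definition second_fundamental_form M z nu (A : V -> V -> R) : Prop :=
  forall X (Y : V -> V), tangent M z X -> differentiable Y z ->
    (\forall p \near z, M p -> tangent M p (Y p)) ->
    A X (Y z) = dot (nabla z X Y) nu.

Definition orthonormal_basis T (m : nat) (e : 'I_m -> V) : Prop :=
  [/\ forall i, T (e i),
      forall i j, dot (e i) (e j) = (i == j)%:R &
      forall X, T X -> exists a : 'I_m -> R, X = \sum_(i < m) a i *: e i].

Definition matrix_in (A : V -> V -> R) (m : nat) (e : 'I_m -> V) : 'M[R]_m :=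
  \matrix_(i, j) A (e i) (e j).

(* s lists the eigenvalues of B with their (algebraic) multiplicities *)
Definition eigenvalues (m : nat) (B : 'M[R]_m) (s : seq R) : Prop :=
  char_poly B = \prod_(a <- s) ('X - a%:P).

(* By convention this is 0 in every nonpositive degree, including degree 0. *)
Definition elem_sym (r : int) (s : seq R) : R :=
  if r <= 0 then 0
  else \sum_(I : {set 'I_(size s)} | #|I| == `|r|%N) \prod_(i in I) s`_i.

(* x is the value Q^(r), for the restriction Q of A to T *)
Definition form_elem_sym T (A : V -> V -> R) (r : int) (x : R) : Prop :=
  exists (m : nat) (e : 'I_m -> V) (s : seq R),
    [/\ orthonormal_basis T e, eigenvalues (matrix_in A e) s & x = elem_sym r s].

(* These two conditions do not depend on the sign of the unit normal, nor on
   the representative z of the point. *)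
Definition austere M : Prop :=
  forall z nu A, M z -> dot z z = 1 -> unit_normal M z nu ->
    second_fundamental_form M z nu A ->
    forall j : nat, (j <= n)%N -> exists x : R,
      form_elem_sym (tangent M z) A (2 * j%:Z + 1) x /\
      form_elem_sym (hol M z nu) A (2 * j%:Z - 1) x.

Definition stark M : Prop :=
  austere M /\
  forall z nu A, M z -> dot z z = 1 -> unit_normal M z nu ->
    second_fundamental_form M z nu A ->
    forall X Y, hol M z nu X -> hol M z nu Y -> A (J X) (J Y) = - A X Y.

Definition standard_basis M z nu (e : 'I_(n + n + 1) -> V) : Prop :=
  [/\ orthonormal_basis (tangent M z) e,
      e (rshift (n + n) ord0) = W nu &
      forall j : 'I_n,
        phi nu (e (lshift 1 (lshift n j))) = e (lshift 1 (rshift n j))].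

Definition split_basis M z nu (k l : nat)
    (e : 'I_((k + k) + (l + l + 1)) -> V) : Prop :=
  [/\ orthonormal_basis (tangent M z) e,
      e (rshift (k + k) (rshift (l + l) ord0)) = W nu,
      (forall j : 'I_k, phi nu (e (lshift (l + l + 1) (lshift k j))) =
                        e (lshift (l + l + 1) (rshift k j))) &
      (forall j : 'I_l, phi nu (e (rshift (k + k) (lshift 1 (lshift l j)))) =
                        e (rshift (k + k) (lshift 1 (rshift l j))))].

End Projective.

Section Normal_forms.
Variable R : realType.

(* 0    S  d
   S    0  0
   d^t  0  0 *)
Definition standard_mx (l : nat) (S : 'M[R]_l) (d : 'cV[R]_l) :
    'M[R]_(l + l + 1) :=
  block_mx (block_mx 0 S S 0) (col_mx d 0) (row_mx d^T 0) 0.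

(* P   Q  0    0  0
   Q  -P  0    0  0
   0   0  0    S  d
   0   0  S    0  0
   0   0  d^t  0  0 *)
Definition split_mx (k l : nat) (P Q : 'M[R]_k) (S : 'M[R]_l) (d : 'cV[R]_l) :
    'M[R]_((k + k) + (l + l + 1)) :=
  block_mx (block_mx P Q Q (- P)) 0 0 (standard_mx S d).

End Normal_forms.

(* Main.v *)
Require Import Defs.
From HB Require Import structures.
From mathcomp Require Import all_boot all_order all_algebra perm.
From mathcomp Require Import all_classical all_reals all_analysis.
From mathcomp Require Import zify ring lra.
Import Order.TTheory GRing.Theory Num.Theory numFieldNormedType.Exports.
Local Open Scope classical_set_scope.
Local Open Scope ring_scope.

(** The result is pointwise: it follows from linear algebra in the tangent space
    once the second fundamental form is known to be a symmetric bilinear form on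
    the hyperplane of horizontal vectors orthogonal to nu.

    The latter is proved with a local equation F of the cone over M.  Curves in
    the zero set of F with given velocity exist by a one-dimensional implicit
    function argument [implicit_curve], so tangent vectors are the horizontal
    vectors killing F.  Extending a tangent vector by an explicit field shows that
    A is minus the Hessian of F divided by the derivative of F along nu
    [sff_hessian], and it is symmetric by Schwarz's theorem [schwarz].

    For the linear algebra, let At be the operator of the restriction of A to the
    holomorphic distribution D, a complex space of dimension n, and let b in D be
    given by <b, X> = A(W, X).  The stark condition says that At anticommutes with
    J.  Hence At is conjugate to - At, its characteristic polynomial is even, and
    the austere condition says that the characteristic polynomial of A is odd.
    Expanding the latter along the row of W, one finds that this means A(W, W) = 0
    and <b, At^j b> = 0 for all odd j [odd_moments_eq0].

    The operator B = At J is symmetric and anticommutes with J.  Let L be the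
    span of the vectors b B^i.  Its pairing with L J is expressed by the numbers
    <b B^i J, b>; they vanish for odd i by the condition on moments, and for even
    i because J is skew.  So L is orthogonal to L J, At exchanges L and L J, and
    A vanishes on L and on L J.  An orthonormal basis of L, its image under J and
    W give the blocks S and d, and a unitary basis of the orthogonal complement of
    L + L J in D, which At preserves, gives the blocks P and Q [split_frames].  If
    the complement is trivial, the basis is standard, and d is nonzero because
    d = 0 means b = 0, hence L = 0.

    Vectors are rows, on which operators act from the right: an orthonormal family
    is a matrix E with E E^T = 1, and the form of matrix C takes the value
    x C y^T. *)

Set Implicit Arguments.
Unset Strict Implicit.
Unset Printing Implicit Defensive.

(** * Characteristic polynomials and moments *)

Lemma char_poly_conj (R : comNzRingType) (n : nat) (B C D : 'M[R]_n) :
  C *m D = 1%:M -> char_poly (C *m B *m D) = char_poly B.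
Proof.
move=> CD; pose C' := map_mx polyC C; pose D' := map_mx polyC D.
have CD' : C' *m D' = 1%:M by rewrite -map_mxM CD map_mx1.
have -> : char_poly (C *m B *m D) = \det (C' *m char_poly_mx B *m D').
  rewrite /char_poly /char_poly_mx mulmxBr mulmxBl !map_mxM.
  by rewrite mul_mx_scalar -scalemxAl CD' scalemx1.
rewrite !det_mulmx mulrAC -det_mulmx CD' det1 mul1r //.
Qed.

(** A form has the same eigenvalues in any two orthonormal bases E and E' of the
    same space: the two change of basis matrices C and D are transposes and
    inverses of each other, which also forces p = q. *)
Lemma frame_change (R : fieldType) (p q N : nat)
    (E : 'M[R]_(p, N)) (E' : 'M[R]_(q, N)) (H : 'M[R]_N) :
  E *m E^T = 1%:M -> E' *m E'^T = 1%:M ->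
  (exists C, E' = C *m E) -> (exists D, E = D *m E') ->
  p = q /\ char_poly (E *m H *m E^T) = char_poly (E' *m H *m E'^T).
Proof.
move=> EE EE' [C E'C] [D ED].
have CC : C *m C^T = 1%:M.
  by rewrite -EE' E'C trmx_mul mulmxA -(mulmxA C E) EE mulmx1.
have DE : D = C^T.
  have : E *m E'^T = D by rewrite ED -mulmxA EE' mulmx1.
  by move=> <-; rewrite E'C trmx_mul mulmxA EE mul1mx.
have DD : C^T *m C = 1%:M.
  by move: EE; rewrite ED trmx_mul mulmxA -(mulmxA D E') EE' mulmx1 DE trmxK.
have pq : p = q.
  apply/eqP; rewrite eqn_leq; apply/andP; split.
    rewrite -[X in (X <= _)%N](mxrank1 R p) -DD.
    by rewrite (leq_trans (mxrankM_maxl _ _)) // rank_leq_col.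
  rewrite -[X in (X <= _)%N](mxrank1 R q) -CC.
  by rewrite (leq_trans (mxrankM_maxl _ _)) // rank_leq_col.
split=> //; subst q; rewrite E'C trmx_mul !mulmxA -(mulmxA C E H).
by rewrite -(mulmxA C (E *m H)) char_poly_conj.
Qed.

Section Parity.
Variable R : comNzRingType.

(** [parity false p] says that p is an even polynomial, [parity true p] that p
    is an odd one. *)
Definition parity (o : bool) (p : {poly R}) : Prop :=
  forall i, odd i != o -> p`_i = 0.

Lemma parityXM o p : parity o p -> parity (~~ o) ('X * p).
Proof.
move=> po [|i]; first by rewrite coefXM.
by rewrite coefXM /= => io; apply: po; move: io; case: (odd i); case: o.
Qed.

Lemma parityB o p q : parity o p -> parity o q -> parity o (p - q).
Proof. by move=> po qo i io; rewrite coefB po // qo // subr0. Qed.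

Lemma parityZ o (c : R) p : parity o p -> parity o (c *: p).
Proof. by move=> po i io; rewrite coefZ po // mulr0. Qed.

End Parity.

(** Schur complement formula for the determinant, freed of inverses: right
    multiplication by the block matrix of columns (1, 0) and
    (- adj X u, det X) makes the bordered matrix block triangular, at the price
    of a factor det X, which cancels. *)
Lemma det_bordered (R : idomainType) (N : nat) (X : 'M[R]_N)
    (u : 'cV[R]_N) (v : 'rV[R]_N) (c : 'M[R]_1) :
  \det X != 0 ->
  \det (block_mx X u v c) = c 0 0 * \det X - (v *m \adj X *m u) 0 0.
Proof.
move=> X0; apply: (mulIf X0).
have E : block_mx X u v c *m block_mx 1%:M (- (\adj X *m u)) 0 (\det X)%:M =
    block_mx X 0 v (c *m (\det X)%:M - v *m \adj X *m u).
  rewrite mulmx_block !mulmx1 !mulmx0 !addr0 !mulmxN !mulmxA mul_mx_adj.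
  by rewrite mul_scalar_mx mul_mx_scalar addNr addrC.
have := congr1 determinant E.
rewrite det_mulmx det_ublock det1 mul1r det_lblock det_scalar expr1 => ->.
by rewrite mulrC det_mx11 mul_mx_scalar !mxE [\det X * _]mulrC.
Qed.

Lemma char_poly_bordered (R : idomainType) (N : nat) (B : 'M[R]_N)
    (b : 'rV[R]_N) (w : R) :
  char_poly (block_mx B b^T b w%:M) = ('X - w%:P) * char_poly B -
    (map_mx polyC b *m \adj (char_poly_mx B) *m (map_mx polyC b)^T) 0 0.
Proof.
rewrite /char_poly /char_poly_mx map_block_mx scalar_mx_block.
rewrite opp_block_mx add_block_mx !add0r det_bordered; last first.
  by rewrite monic_neq0 // char_poly_monic.
rewrite mulNmx mulNmx mulmxN opprK map_trmx.
by rewrite map_scalar_mx /= !mxE eqxx !mulr1n.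
Qed.

Lemma size_det_leq (R : idomainType) (n : nat) (X : 'M[{poly R}]_n) :
  (forall i j, (size (X i j) <= 2)%N) -> (size (\det X) <= n.+1)%N.
Proof.
move=> X2; rewrite /determinant (leq_trans (size_sum _ _ _)) //.
apply/bigmax_leqP => s _; rewrite -signr_odd mulr_sign.
have le : (size (\prod_i X i (s i) : {poly R})%R <= n.+1)%N.
  rewrite (leq_trans (size_prod_leq _ _)) // cardT size_enum_ord.
  have : (\sum_(i < n) size (X i (s i)) <= \sum_(i < n) 2)%N.
    by apply: leq_sum => i _.
  by rewrite sum_nat_const card_ord leq_subLR muln2 -addnn addnS.
by case: ifP => _; rewrite ?size_polyN.
Qed.

Lemma size_adj_char_poly_mx (R : idomainType) (N : nat) (B : 'M[R]_N) i j :
  (size ((\adj (char_poly_mx B)) i j) <= N)%N.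
Proof.
rewrite mxE /cofactor -signr_odd mulr_sign.
have le : (size (\det (row' j (col' i (char_poly_mx B)))) <= N)%N.
  case: N B i j => [|N] B i j; first by case: i.
  apply: size_det_leq => k l; rewrite !mxE.
  rewrite (leq_trans (size_polyD _ _)) // geq_max size_polyN.
  rewrite (leq_trans (size_polyC_leq1 _)) // andbT.
  by case: eqP => _; rewrite ?mulr1n ?size_polyX ?mulr0n ?size_poly0.
by case: ifP => _; rewrite ?size_polyN.
Qed.

(** Let q_j(t) = b B^j adj(t - B) b^T, and let s_j = b B^j b^T be the j-th
    moment.  From (t - B) adj(t - B) = chi(t) one gets
    q_{j+1} = t q_j - s_j chi, and the bordered characteristic polynomial is
    (t - w) chi - q_0.  As chi is monic and even, of even degree N, and q_0 has
    degree less than N, oddness of this difference gives w = 0 and then that q_0 is odd.  The recursion keeps q_j odd for even j and even for odd j: for odd j,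
    the coefficient of degree N of q_{j+1} vanishes for degree reasons and that
    of t q_j by parity, so that s_j = 0. *)
Lemma odd_moments_eq0 (R : idomainType) (N : nat) (B : 'M[R]_N)
    (b : 'rV[R]_N) (w : R) : ~~ odd N ->
  parity false (char_poly B) ->
  parity true (char_poly (block_mx B b^T b w%:M)) ->
  w = 0 /\ forall j, odd j -> (b *m B ^+ j *m b^T) 0 0 = 0.
Proof.
move=> Nev chiB; rewrite char_poly_bordered => chiA.
pose X := char_poly_mx B.
pose C j : 'rV[{poly R}]_N := map_mx polyC (b *m B ^+ j).
pose q j : {poly R} := (C j *m \adj X *m (map_mx polyC b)^T) 0 0.
pose s j : R := (b *m B ^+ j *m b^T) 0 0.
have rec j : q j.+1 = 'X * q j - s j *: char_poly B.
  have E : 'X *: C j - C j.+1 = C j *m X.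
    have BS : B ^+ j.+1 = B ^+ j *m B by exact: exprSr.
    by rewrite /X /C /char_poly_mx mulmxBr mul_mx_scalar BS mulmxA -map_mxM.
  have : (C j *m X *m \adj X *m (map_mx polyC b)^T) 0 0 = s j *: char_poly B.
    rewrite -(mulmxA (C j)) mul_mx_adj mul_mx_scalar -scalemxAl mxE.
    by rewrite map_trmx -map_mxM mxE mulrC mul_polyC.
  rewrite -E !mulmxBl mxE [X in _ + X]mxE -!scalemxAl mxE -/(q j) -/(q j.+1).
  by move=> <-; rewrite opprD opprK addNKr.
have size_q j : (q j)`_N = 0.
  apply: nth_default; rewrite /q mxE (leq_trans (size_sum _ _ _)) //.
  apply/bigmax_leqP => k _; rewrite !mxE mulr_suml.
  rewrite (leq_trans (size_sum _ _ _)) //.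
  apply/bigmax_leqP => i _; rewrite !(mxE, mul_polyC) mulrC mul_polyC.
  rewrite (leq_trans (size_scale_leq _ _)) // (leq_trans (size_scale_leq _ _)) //.
  by have := size_adj_char_poly_mx B i k; rewrite mxE.
have chiN : (char_poly B)`_N = 1.
  have /monicP := char_poly_monic B.
  by rewrite /lead_coef size_char_poly.
(* compare the coefficients of degree N, which is even *)
have w0 : w = 0.
  have := chiA N; rewrite eqb_id => /(_ Nev) /eqP.
  have := size_q 0%N; rewrite /q /C expr0 mulmx1 coefB => ->.
  rewrite subr0 mulrBl coefB coefCM chiN (parityXM chiB) ?eqb_id //.
  by rewrite sub0r mulr1 oppr_eq0 => /eqP.
split=> //; move: chiA; rewrite w0 subr0 => chiA.
have q0 : parity true (q 0%N).
  rewrite (_ : q 0%N = 'X * char_poly B -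
    ('X * char_poly B - (map_mx polyC b *m \adj X *m (map_mx polyC b)^T) 0 0)).
    by apply: parityB => //; exact: (parityXM chiB).
  by rewrite subKr /q /C expr0 mulmx1.
have main j : parity (~~ odd j) (q j) /\ (odd j -> s j = 0).
  have odds j' : parity (~~ odd j') (q j') -> odd j' -> s j' = 0.
    move=> /parityXM par jodd; move: (size_q j'.+1).
    rewrite rec coefB coefZ chiN mulr1 par ?jodd ?eqb_id // sub0r.
    by move/eqP; rewrite oppr_eq0 => /eqP.
  elim: j => [|j [par sj]]; first by split.
  have parS : parity (~~ odd j.+1) (q j.+1).
    rewrite rec; apply: parityB; first by have := parityXM par.
    case: (boolP (odd j)) => jo; last by rewrite /= negbK (negbTE jo); exact: parityZ.
    by rewrite sj // scale0r => i _; rewrite coef0.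
  by split=> //; exact: odds.
by move=> j jo; exact: (main j).2.
Qed.

Section Coef.
Variable R : comNzRingType.

Lemma coef_comp_polyN (p : {poly R}) i : (p \Po - 'X)`_i = (-1) ^+ i * p`_i.
Proof.
rewrite comp_polyE coef_sum.
have E (j : nat) : (p`_j *: (- 'X) ^+ j)`_i = p`_j * (-1) ^+ j *+ (i == j) :> R.
  rewrite coefZ -scaleN1r exprZn coefZ coefXn; case: eqP => _.
    by rewrite mulr1.
  by rewrite !mulr0.
have [ip|pi] := ltnP i (size p).
  rewrite (bigD1 (Ordinal ip)) //= E eqxx mulr1n big1 ?addr0 1?mulrC // => j ji.
  by rewrite E; case: eqP => // ij; case/eqP: ji; apply: val_inj.
rewrite (nth_default 0 pi) mulr0 big1 // => j _.
by rewrite E; case: eqP => // ij; move: pi; rewrite ij leqNgt ltn_ord.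
Qed.

(** Substituting - X for X in det (X - B) gives det (- (X + B)). *)
Lemma char_polyN n (B : 'M[R]_n) i :
  (char_poly (- B))`_i = (-1) ^+ (n + i) * (char_poly B)`_i.
Proof.
rewrite exprD -mulrA -coef_comp_polyN.
have -> : char_poly B \Po (- 'X) = (-1) ^+ n *: char_poly (- B).
  rewrite /char_poly -[LHS](det_map_mx (comp_poly (- 'X))) /char_poly_mx.
  have -> : map_mx (comp_poly (- 'X)) ('X%:M - map_mx polyC B) =
      - ('X%:M - map_mx polyC (- B)).
    apply/matrixP => r s; rewrite !mxE rmorphB /= comp_polyC polyCN opprB.
    case: eqP => _; first by rewrite !mulr1n comp_polyX addrC.
    by rewrite !mulr0n comp_poly0 add0r subr0.
  by rewrite -scaleN1r detZ -mul_polyC rmorphXn rmorphN1.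
by rewrite coefZ mulrA -expr2 sqrr_sign mul1r.
Qed.

Lemma even_char_poly n (B : 'M[R]_n) : (forall x : R, x *+ 2 = 0 -> x = 0) ->
  ~~ odd n -> char_poly B = char_poly (- B) -> parity false (char_poly B).
Proof.
move=> R2 n_even BN i; rewrite eqbF_neg negbK => i_odd.
have := char_polyN B i; rewrite -BN -signr_odd oddD.
rewrite i_odd (negbTE n_even) expr1 mulN1r => /eqP; rewrite -addr_eq0 -mulr2n.
by move=> /eqP /R2.
Qed.

End Coef.

(** * Totally real frames and the cyclic splitting *)

Section Frames.
Variables (R : rcfType) (N : nat) (K : 'M[R]_N).
Hypotheses (KT : K^T = - K) (KK : K *m K = - 1%:M).
Local Notation V := 'rV[R]_N.

Lemma sqnorm_ge0 (x : V) : 0 <= (x *m x^T) 0 0.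
Proof. by rewrite mxE sumr_ge0 // => i _; rewrite mxE -expr2 sqr_ge0. Qed.

Lemma sqnorm_eq0 (x : V) : (x *m x^T) 0 0 = 0 -> x = 0.
Proof.
rewrite mxE => /eqP; rewrite psumr_eq0 => [/allP h|i _]; last first.
  by rewrite mxE -expr2 sqr_ge0.
apply/rowP => i; rewrite mxE; have := h i; rewrite mem_index_enum => /(_ isT).
by rewrite mxE -expr2 sqrf_eq0 => /eqP.
Qed.

Lemma mx11_tr (A : 'M[R]_1) : A^T = A.
Proof. by rewrite [A]mx11_scalar tr_scalar_mx. Qed.

Lemma skew_form_eq0 (x : V) : x *m K *m x^T = 0.
Proof.
have : (x *m K *m x^T)^T = - (x *m K *m x^T).
  by rewrite !trmx_mul trmxK KT mulNmx mulmxN mulmxA.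
rewrite mx11_tr => /eqP; rewrite -addr_eq0 -mulr2n.
rewrite -scaler_nat scaler_eq0 pnatr_eq0 /= => /eqP //.
Qed.

Definition lin_closed (S : V -> Prop) : Prop :=
  S 0 /\ forall (a : R) x y, S x -> S y -> S (a *: x + y).

Lemma lin_closedD S x y : lin_closed S -> S x -> S y -> S (x + y).
Proof. by move=> [_ h] Sx Sy; rewrite -[x]scale1r; apply: h. Qed.

Lemma lin_closedN S x : lin_closed S -> S x -> S (- x).
Proof. by move=> [h0 h] Sx; rewrite -scaleN1r -[_ *: _]addr0; apply: h. Qed.

Lemma lin_closed_mul S m (c : 'rV[R]_m) (F : 'M[R]_(m, N)) :
  lin_closed S -> (forall i, S (row i F)) -> S (c *m F).
Proof.
move=> linS SF; rewrite mulmx_sum_row; elim/big_rec: _ => [|i x _ Sx].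
  exact: linS.1.
exact: linS.2.
Qed.

(** The rows of F are orthonormal and their span is orthogonal to its image
    under K; equivalently, the rows of F together with those of F K form an
    orthonormal family, adapted to the complex structure K. *)
Definition totally_real m (F : 'M[R]_(m, N)) : Prop :=
  F *m F^T = 1%:M /\ F *m K *m F^T = 0.

Lemma totally_real_extend m (F : 'M[R]_(m, N)) (x : V) :
  totally_real F -> x != 0 -> x *m F^T = 0 -> x *m K *m F^T = 0 ->
  exists c : R, totally_real (col_mx F (c *: x)).
Proof.
move=> [FF FK] x0 xF xKF.
have p : 0 < (x *m x^T) 0 0.
  rewrite lt_neqAle sqnorm_ge0 andbT eq_sym; apply: contraNneq x0.
  by move=> /sqnorm_eq0 ->.
exists (Num.sqrt ((x *m x^T) 0 0))^-1.
set c := (_^-1).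
have xx : (c *: x) *m (c *: x)^T = 1%:M.
  rewrite linearZ /= -scalemxAl -scalemxAr scalerA [x *m x^T]mx11_scalar.
  rewrite scale_scalar_mx /c -invfM -expr2 sqr_sqrtr ?ltW // mulVf //.
  by rewrite gt_eqF.
have Fx : F *m x^T = 0 by apply: trmx_inj; rewrite trmx_mul trmxK xF trmx0.
have FKx : F *m K *m x^T = 0.
  apply: trmx_inj; rewrite !trmx_mul trmxK KT mulNmx mulmxN mulmxA xKF.
  by rewrite oppr0 trmx0.
split.
  rewrite tr_col_mx mul_col_row FF xx linearZ /= -scalemxAr Fx.
  by rewrite -scalemxAl xF !scaler0 -scalar_mx_block.
rewrite mul_col_mx tr_col_mx mul_col_row FK linearZ /= -scalemxAr FKx.
rewrite -!scalemxAl xKF -scalemxAr skew_form_eq0 !scaler0.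
by rewrite block_mx0.
Qed.

Lemma orthonormal_leq m (F : 'M[R]_(m, N)) : F *m F^T = 1%:M -> (m <= N)%N.
Proof.
move=> FF; rewrite -[X in (X <= _)%N](mxrank1 R m) -FF.
by rewrite (leq_trans (mxrankM_maxl _ _)) // rank_leq_col.
Qed.

(** A totally real frame of vectors of S that cannot be enlarged within S exists
    because its size is at most N.  Two uses: if S is K-stable, the frame and its
    image span S; if S is orthogonal to its image under K, the frame alone spans
    S. *)
Lemma maximal_frame (S : V -> Prop) : lin_closed S ->
  exists m (F : 'M[R]_(m, N)), [/\ totally_real F, forall i, S (row i F) &
    forall x, S x -> x *m F^T = 0 -> x *m K *m F^T = 0 -> x = 0].
Proof.
move=> linS.
suff H d : forall m (F : 'M[R]_(m, N)), totally_real F ->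
    (forall i, S (row i F)) -> (N - m < d)%N ->
  exists m (F : 'M[R]_(m, N)), [/\ totally_real F, forall i, S (row i F) &
    forall x, S x -> x *m F^T = 0 -> x *m K *m F^T = 0 -> x = 0].
  apply: (H N.+1 0%N (0 : 'M[R]_(0, N))); last by rewrite subn0 ltnS.
    by split; apply/matrixP; case.
  by case.
elim: d => [//|d IH] m F tF SF lt.
have [[x [Sx xF xK x0]]|/forallNP nE] := pselect (exists x,
    [/\ S x, x *m F^T = 0, x *m K *m F^T = 0 & x != 0]); last first.
  exists m, F; split=> // x Sx xF xK; apply/eqP/negPn/negP => x0.
  by apply: (nE x).
have [c tc] := totally_real_extend tF x0 xF xK.
apply: (IH _ _ tc); last first.
  have := orthonormal_leq tc.1; rewrite addn1 => mN.
  by rewrite -ltnS (leq_trans _ lt) // ltnS subnSK.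
move=> i; rewrite -(fintype.splitK i); case: (fintype.split i) => j /=.
  by rewrite rowKu.
by rewrite rowKd row_id -[_ *: _]addr0; apply: linS.2 => //; exact: linS.1.
Qed.

End Frames.

(** A symmetric operator At that anticommutes with the complex structure K is
    traded for B = At K, which is symmetric, anticommutes with K as well and
    satisfies B^2 = At^2. *)
Section Cyclic.
Variables (R : rcfType) (N : nat) (K At : 'M[R]_N) (b : 'rV[R]_N).
Hypotheses (KT : K^T = - K) (KK : K *m K = - 1%:M).
Hypotheses (AtT : At^T = At) (AtK : At *m K = - (K *m At)).
Local Notation B := (At *m K).

Lemma twisted_tr : B^T = B.
Proof. by rewrite trmx_mul KT AtT mulNmx AtK. Qed.

Lemma K_twisted : K *m B = - (B *m K).
Proof. by rewrite mulmxA AtK mulNmx opprK. Qed.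

Lemma twisted_K : B *m K = - At.
Proof. by rewrite -mulmxA KK mulmxN mulmx1. Qed.

Lemma expmxS (C : 'M[R]_N) i : C ^+ i.+1 = C ^+ i *m C.
Proof. exact: exprSr. Qed.

Lemma K_twistedX i : K *m B ^+ i = (-1) ^+ i *: (B ^+ i *m K).
Proof.
elim: i => [|i IH]; first by rewrite !expr0 scale1r mulmx1 mul1mx.
rewrite !expmxS mulmxA IH -scalemxAl -(mulmxA _ K) K_twisted mulmxN.
by rewrite scalerN exprS mulN1r scaleNr !mulmxA.
Qed.

Lemma twistedX_even i : B ^+ i.*2 = At ^+ i.*2.
Proof.
have BB : B *m B = At *m At.
  by rewrite -mulmxA K_twisted mulmxN twisted_K mulmxN opprK.
elim: i => [//|i IH]; rewrite doubleS !expmxS IH -2!(mulmxA (At ^+ _)).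
by rewrite BB.
Qed.

Hypothesis moments : forall j, odd j -> b *m At ^+ j *m b^T = 0.

(** For odd i, B^i K is an odd power of At up to sign, and the hypothesis
    applies.  For even i = 2 j, anticommutation turns the expression into the
    value at the vector b B^j of the form of matrix K, which is skew. *)
Lemma twisted_moments i : b *m B ^+ i *m K *m b^T = 0.
Proof.
rewrite -[i]odd_double_half; case: (odd i).
  rewrite add1n expmxS twistedX_even -(mulmxA b _ K) -(mulmxA (At ^+ _) B K) twisted_K.
  by rewrite mulmxN -expmxS mulmxN mulNmx moments ?oppr0 //= odd_double.
rewrite add0n -addnn exprD.
have -> : B ^+ i./2 * B ^+ i./2 = B ^+ i./2 *m B ^+ i./2 by [].
have BXT : (B ^+ i./2)^T = B ^+ i./2.
  elim: (i./2) => [|j IH]; first by rewrite expr0 trmx1.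
  by rewrite {1}expmxS trmx_mul IH twisted_tr; apply/esym; exact: exprS.
have -> : b *m (B ^+ i./2 *m B ^+ i./2) *m K *m b^T =
    b *m B ^+ i./2 *m (B ^+ i./2 *m K) *m b^T by rewrite !mulmxA.
have -> : B ^+ i./2 *m K = (-1) ^+ i./2 *: (K *m B ^+ i./2).
  by rewrite K_twistedX scalerA -exprD addnn -signr_odd odd_double expr0 scale1r.
rewrite -scalemxAr -scalemxAl.
have := skew_form_eq0 KT (b *m B ^+ i./2); rewrite trmx_mul BXT !mulmxA => ->.
by rewrite scaler0.
Qed.

(** The span of the vectors b B^i, as the least B-stable subspace containing
    b. *)
Definition cyclic_space (x : 'rV[R]_N) : Prop :=
  forall S, lin_closed S -> S b -> (forall y, S y -> S (y *m B)) -> S x.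

Lemma cyclic_lin : lin_closed cyclic_space.
Proof.
split=> [S [] //|a x y Lx Ly S linS Sb SB].
by apply: linS.2; [exact: Lx|exact: Ly].
Qed.

Lemma cyclic_gen : cyclic_space b. Proof. by []. Qed.

Lemma cyclic_mul x : cyclic_space x -> cyclic_space (x *m B).
Proof. by move=> Lx S linS Sb SB; apply: (SB); exact: Lx. Qed.

(** As B anticommutes with K, the pairing of b B^i and b B^j K is up to sign
    that of b B^(i+j) K and b. *)
Lemma cyclic_real x y : cyclic_space x -> cyclic_space y ->
  x *m K *m y^T = 0.
Proof.
have P z : cyclic_space z -> forall i, z *m K *m (b *m B ^+ i)^T = 0.
  move=> Lz; apply: (Lz (fun z => forall i, z *m K *m (b *m B ^+ i)^T = 0)).
  - split=> [i|a u v Pu Pv i]; first by rewrite !mul0mx.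
    by rewrite !mulmxDl -!scalemxAl Pu Pv scaler0 addr0.
  - move=> i; apply: trmx_inj; rewrite trmx_mul trmxK trmx_mul KT mulNmx mulmxN.
    by rewrite mulmxA twisted_moments oppr0 trmx0.
  - move=> u Pu i; rewrite -(mulmxA u B K) -[B *m K]opprK -K_twisted.
    have E : B *m (b *m B ^+ i)^T = (b *m B ^+ i.+1)^T.
      by rewrite expmxS (mulmxA b _ B) [RHS]trmx_mul twisted_tr.
    by rewrite mulmxN mulNmx (mulmxA u K B) -(mulmxA (u *m K) B) E Pu oppr0.
move=> Lx /(_ (fun z => forall u, cyclic_space u -> u *m K *m z^T = 0)).
apply=> //.
- split=> [u _|a u v Pu Pv w Lw]; first by rewrite trmx0 mulmx0.
  by rewrite linearP /= mulmxDr -scalemxAr Pu // Pv // scaler0 addr0.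
- by move=> u /P /(_ 0%N); rewrite expr0 mulmx1.
- move=> u Pu w Lw; rewrite (trmx_mul u B) twisted_tr (mulmxA _ B) -(mulmxA w K B) K_twisted.
  by rewrite mulmxN mulNmx (mulmxA w B K) Pu ?oppr0 //; exact: cyclic_mul.
Qed.

Variable Pr : 'M[R]_N.
Hypotheses (PrT : Pr^T = Pr) (PrPr : Pr *m Pr = Pr).
Hypotheses (KPr : K *m Pr = Pr *m K) (AtPr : At *m Pr = At) (bPr : b *m Pr = b).

Lemma cyclic_sub x : cyclic_space x -> x *m Pr = x.
Proof.
move=> Lx; apply: (Lx (fun x => x *m Pr = x)) => //.
  split=> [|a u v Pu Pv]; first by rewrite mul0mx.
  by rewrite mulmxDl -scalemxAl Pu Pv.
by move=> y _; rewrite -!mulmxA KPr !mulmxA -(mulmxA y) AtPr.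
Qed.

Lemma mx_rowP m (F : 'M[R]_(m, N)) p (C D : 'M[R]_(N, p)) :
  (forall i, row i F *m C = row i F *m D) -> F *m C = F *m D.
Proof. by move=> h; apply/row_matrixP => i; rewrite !row_mul h. Qed.

Lemma mx_row0 m (F : 'M[R]_(m, N)) p (C : 'M[R]_(N, p)) :
  (forall i, row i F *m C = 0) -> F *m C = 0.
Proof. by move=> h; rewrite -(mulmx0 _ F); apply: mx_rowP => i; rewrite mulmx0. Qed.

Lemma frame_residue m (F : 'M[R]_(m, N)) (x : 'rV[R]_N) :
  totally_real K F ->
  let r := x - x *m F^T *m F - x *m (F *m K)^T *m (F *m K) in
  r *m F^T = 0 /\ r *m K *m F^T = 0.
Proof.
move=> [FF FK] /=.
have FK' : F *m (K *m F^T) = 0 by rewrite mulmxA.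
have FKFK : F *m (K *m (K *m F^T)) = - 1%:M.
  by rewrite (mulmxA K) KK mulNmx mul1mx mulmxN FF.
split.
  by rewrite !mulmxBl -!mulmxA FF mulmx1 subrr FK' !mulmx0 subr0.
rewrite !mulmxBl -!mulmxA FK' FKFK !mulmx0 subr0.
by rewrite trmx_mul KT !mulmxN mulmx1 mulNmx mulmxN opprK subrr.
Qed.

(** The orthogonal splitting of a complex subspace, given by its orthogonal
    projector Pr, that At and b determine.  The frame F spans the cyclic space L
    of b; as L is B-stable and orthogonal to L K, the operator At = - B K maps
    L into L K and L K into L.  The frame G, with G K, spans the orthogonal
    complement of L + L K in the range of Pr, which At therefore preserves. *)
Lemma split_frames :
  exists k l (G : 'M[R]_(k, N)) (F : 'M[R]_(l, N)),
  [/\ [/\ totally_real K G, totally_real K F, G *m F^T = 0 & G *m K *m F^T = 0],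
      [/\ G *m Pr = G, F *m Pr = F &
       Pr = G^T *m G + (G *m K)^T *m (G *m K)
          + (F^T *m F + (F *m K)^T *m (F *m K))],
      [/\ F *m At *m F^T = 0, G *m At *m F^T = 0 & G *m At *m (F *m K)^T = 0] &
      b = b *m F^T *m F /\ (b *m F^T = 0 -> l = 0%N)].
Proof.
have [l [F [tF LF maxF]]] := maximal_frame KT cyclic_lin.
have LF_span x : cyclic_space x -> x = x *m F^T *m F.
  move=> Lx; apply/eqP; rewrite -subr_eq0; apply/eqP; apply: maxF.
  - apply: (lin_closedD cyclic_lin) => //; apply: (lin_closedN cyclic_lin).
    exact: (lin_closed_mul _ cyclic_lin).
  - by rewrite mulmxBl -!mulmxA tF.1 mulmx1 subrr.
  - rewrite !mulmxBl -(mulmxA _ F) -(mulmxA _ (F *m K)) tF.2 mulmx0 subr0.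
    apply/rowP => j; rewrite !mxE -[RHS](_ : (x *m K *m (row j F)^T) 0 0 = 0).
      by rewrite mxE; apply: eq_bigr => i _; rewrite !mxE.
    by rewrite cyclic_real // mxE.
(* L is stable under B, and hence L At is contained in L K *)
have FB : F *m B = F *m (B *m F^T *m F).
  by apply: mx_rowP => i; have := LF_span _ (cyclic_mul (LF i)); rewrite !mulmxA.
have FPr : F *m Pr = F.
  by rewrite -[RHS]mulmx1; apply: mx_rowP => i; rewrite cyclic_sub // mulmx1.
have FAt : F *m At = - (F *m B *m F^T *m (F *m K)).
  have -> : F *m At = - (F *m B *m K) by rewrite -(mulmxA F B K) twisted_K mulmxN opprK.
  by rewrite [in LHS]FB !mulmxA.
pose S (x : 'rV[R]_N) := [/\ x *m Pr = x, x *m F^T = 0 & x *m K *m F^T = 0].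
have linS : lin_closed S.
  split; first by split; rewrite !mul0mx.
  move=> a x y [x1 x2 x3] [y1 y2 y3]; split.
  - by rewrite mulmxDl -scalemxAl x1 y1.
  - by rewrite mulmxDl -scalemxAl x2 y2 scaler0 addr0.
  - by rewrite !mulmxDl -!scalemxAl x3 y3 scaler0 addr0.
have SK x : S x -> S (x *m K).
  move=> [x1 x2 x3]; split=> //; first by rewrite -mulmxA KPr mulmxA x1.
  by rewrite -(mulmxA x) KK mulmxN mulmx1 mulNmx x2 oppr0.
have [k [G [tG SG maxG]]] := maximal_frame KT linS.
have GPr : G *m Pr = G.
  by rewrite -[RHS]mulmx1; apply: mx_rowP => i; rewrite mulmx1; case: (SG i).
have GF : G *m F^T = 0 by apply: mx_row0 => i; case: (SG i).
have GKF : G *m K *m F^T = 0.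
  by rewrite -mulmxA; apply: mx_row0 => i; rewrite mulmxA; case: (SG i).
have FG : F *m G^T = 0 by apply: trmx_inj; rewrite trmx_mul trmxK GF trmx0.
have FKG : F *m K *m G^T = 0.
  apply: trmx_inj; rewrite !trmx_mul trmxK KT mulNmx mulmxN mulmxA GKF.
  by rewrite oppr0 trmx0.
exists k, l, G, F; split=> //.
- split=> //.
  (* the residue of a vector after projection to the two parts is in S and
     orthogonal to the maximal frame, so it vanishes *)
  apply/row_matrixP => i; rewrite !rowE; move: (delta_mx 0 i) => x.
  set x1 := x *m Pr.
  pose y := x1 - x1 *m F^T *m F - x1 *m (F *m K)^T *m (F *m K).
  have x1F : x *m F^T = x1 *m F^T by rewrite -mulmxA -PrT -trmx_mul FPr.
  have x1G : x *m G^T = x1 *m G^T by rewrite -mulmxA -PrT -trmx_mul GPr.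
  have x1K m (E : 'M[R]_(m, N)) : E *m Pr = E ->
      x *m (E *m K)^T = x1 *m (E *m K)^T.
    by move=> EPr; rewrite -mulmxA -PrT -trmx_mul -mulmxA KPr mulmxA EPr.
  have Sy : S y.
    have [y1 y2] := frame_residue x1 tF; split=> //.
    rewrite /y !mulmxBl -!mulmxA PrPr FPr KPr (mulmxA F) FPr //.
  have yG : y *m G^T = x *m G^T.
    by rewrite /y !mulmxBl -!mulmxA FG (mulmxA F) FKG !mulmx0 !subr0 mulmxA x1G.
  have yGK : y *m (G *m K)^T = x *m (G *m K)^T.
    have FGK : F *m (G *m K)^T = 0.
      by rewrite trmx_mul KT mulNmx mulmxN mulmxA FKG oppr0.
    have FKGK : F *m K *m (G *m K)^T = 0.
      rewrite trmx_mul KT mulNmx mulmxN -!mulmxA (mulmxA K) KK mulNmx mul1mx.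
      by rewrite mulmxN FG !oppr0.
    rewrite /y !mulmxBl -(mulmxA _ F) -(mulmxA _ (F *m K)) FGK FKGK.
    by rewrite !mulmx0 !subr0 x1K.
  have [r1 r2] := frame_residue y tG.
  have := maxG _ _ r1 r2.
  rewrite yG yGK => y0.
  have /y0 : S (y - x *m G^T *m G - x *m (G *m K)^T *m (G *m K)).
    apply: (lin_closedD linS); last first.
      apply: (lin_closedN linS); rewrite mulmxA; apply: SK.
      exact: lin_closed_mul.
    apply: (lin_closedD linS) => //.
    by apply: (lin_closedN linS); apply: lin_closed_mul.
  rewrite /y -!x1F -x1K // => /eqP; rewrite -!addrA -!opprD subr_eq0 => /eqP E.
  rewrite -/x1 E !mulmxDr !mulmxA.
  by rewrite addrA addrC -addrA.
- have h : F *m At *m F^T = 0.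
    by rewrite FAt mulNmx -(mulmxA _ (F *m K)) tF.2 mulmx0 oppr0.
  have h2 : G *m At *m F^T = 0.
    apply: trmx_inj; rewrite !trmx_mul trmxK AtT mulmxA FAt mulNmx.
    rewrite -(mulmxA _ (F *m K)) FKG.
    by rewrite mulmx0 oppr0 trmx0.
  split=> //; apply: trmx_inj.
  rewrite (trmx_mul (G *m At)) (trmx_mul G At) AtT trmxK trmx0 mulmxA.
  rewrite -(mulmxA F K At) -[K *m At]opprK -AtK mulmxN mulNmx FB !mulmxA.
  by rewrite -(mulmxA _ F) FG mulmx0 oppr0.
- have bF := LF_span _ cyclic_gen.
  split=> // bF0; move: bF; rewrite bF0 mul0mx => b0.
    have L0 x : cyclic_space x -> x = 0.
      move=> Lx; apply: (Lx (fun x => x = 0)) => //; last first.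
        by move=> y ->; rewrite mul0mx.
      by split=> // a u v -> ->; rewrite scaler0 addr0.
    have F0 : F = 0 by apply/row_matrixP => i; rewrite row0; apply: L0.
    have [FF _] := tF; case: (posnP l) => // lt0l; exfalso.
    move: FF; rewrite F0 mul0mx => /matrixP /(_ (Ordinal lt0l) (Ordinal lt0l)).
    rewrite !mxE eqxx => /eqP.
    by rewrite eq_sym oner_eq0.
Qed.

End Cyclic.

Section Complement.
Variables (R : rcfType) (N : nat) (K : 'M[R]_N) (q : nat) (Q : 'M[R]_(q, N)).
Hypotheses (KT : K^T = - K) (KK : K *m K = - 1%:M) (tQ : totally_real K Q).

(** For a totally real frame Q, this is the orthogonal projector to the complement
    of the complex span of its rows. *)
Definition complement_proj : 'M[R]_N := 1%:M - Q^T *m Q - (Q *m K)^T *m (Q *m K).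
Local Notation Pr := complement_proj.

Lemma totally_realK m (G : 'M[R]_(m, N)) : totally_real K G ->
  (G *m K) *m (G *m K)^T = 1%:M /\ G *m (G *m K)^T = 0.
Proof.
move=> [GG GK]; rewrite trmx_mul KT mulNmx !mulmxN mulmxA -(mulmxA G) KK.
by rewrite mulmxN mulmx1 mulNmx GG opprK mulmxA GK oppr0.
Qed.

Lemma complement_tr : Pr^T = Pr.
Proof. by rewrite /Pr !linearB /= !(trmx_mul _ _, trmx1, trmxK). Qed.

Lemma complement_K : K *m Pr = Pr *m K.
Proof.
have -> : Pr = 1%:M - Q^T *m Q + K *m (Q^T *m Q) *m K.
  by rewrite /Pr trmx_mul KT !mulNmx opprK !mulmxA.
move: (Q^T *m Q) => S; rewrite mulmxDr mulmxDl mulmxBr mulmxBl mulmx1 mul1mx.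
by rewrite !mulmxA KK -(mulmxA _ K K) KK mulmxN mulmx1 !mulNmx mul1mx addrAC.
Qed.

Lemma complement_id (x : 'rV[R]_N) : x *m Pr = x <-> x *m Q^T = 0 /\ x *m K *m Q^T = 0.
Proof.
have [QK QQK] := totally_realK tQ.
split=> [<-|[x1 x2]]; last first.
  rewrite /Pr !mulmxBr mulmx1 !mulmxA x1 mul0mx subr0.
  by rewrite trmx_mul KT mulNmx mulmxN mulmxA x2 oppr0 !mul0mx subr0.
have [] := frame_residue KT KK x tQ.
by rewrite /= /Pr !mulmxBr mulmx1 !mulmxA.
Qed.

Lemma complement_idem : Pr *m Pr = Pr.
Proof.
apply/row_matrixP => i; rewrite row_mul; apply/complement_id.
rewrite rowE; have [] := frame_residue KT KK (delta_mx 0 i) tQ.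
by rewrite /= /Pr !mulmxBr mulmx1 !mulmxA.
Qed.

(** Traces of projectors count dimensions. *)
Lemma trace_frame m (G : 'M[R]_(m, N)) : G *m G^T = 1%:M ->
  \tr (G^T *m G) = m%:R.
Proof. by move=> GG; rewrite mxtrace_mulC GG mxtrace1. Qed.

Lemma trace_complement : \tr Pr = N%:R - q.*2%:R.
Proof.
have [QK _] := totally_realK tQ.
rewrite /Pr !linearB /= mxtrace1 !trace_frame //; last exact: tQ.1.
by rewrite -addnn natrD opprD addrA.
Qed.

End Complement.

(** * The Hermitian structure *)

Section Dot.
Variables (R : realType) (n : nat).
Local Notation V := (cspace R n).
Implicit Types u v w : V.

Definition Jmx : 'M[R]_(n.+2 + n.+2) := block_mx 0 1%:M (- 1%:M) 0.

Lemma JE u : J u = u *m Jmx. Proof. by []. Qed.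

Lemma Jmx_tr : Jmx^T = - Jmx.
Proof.
rewrite /Jmx tr_block_mx !trmx0 linearN /= trmx1 opp_block_mx oppr0 opprK.
by [].
Qed.

Lemma Jmx_sqr : Jmx *m Jmx = - 1%:M.
Proof.
rewrite /Jmx mulmx_block !mul0mx !mulmx0 !mul1mx !mulmx1 !add0r !addr0.
by rewrite scalar_mx_block opp_block_mx oppr0.
Qed.

Lemma JK u : J (J u) = - u.
Proof. by rewrite !JE -mulmxA Jmx_sqr mulmxN mulmx1. Qed.

Lemma dotC u v : dot u v = dot v u.
Proof. by rewrite /dot !mxE; apply: eq_bigr => i _; rewrite !mxE mulrC. Qed.

Lemma dotDl u v w : dot (u + v) w = dot u w + dot v w.
Proof. by rewrite /dot mulmxDl mxE. Qed.

Lemma dotZl (a : R) u w : dot (a *: u) w = a * dot u w.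
Proof. by rewrite /dot -scalemxAl mxE. Qed.

Lemma dotNl u w : dot (- u) w = - dot u w.
Proof. by rewrite /dot mulNmx mxE. Qed.

Lemma dotBl u v w : dot (u - v) w = dot u w - dot v w.
Proof. by rewrite dotDl dotNl. Qed.

Lemma dotNr u w : dot w (- u) = - dot w u.
Proof. by rewrite dotC dotNl (dotC w). Qed.

Lemma dot_Jl u v : dot (J u) v = - dot u (J v).
Proof.
rewrite /dot !JE trmx_mul Jmx_tr mulNmx mulmxN mulmxA.
by rewrite [in RHS]mxE opprK.
Qed.

Lemma dotJJ u v : dot (J u) (J v) = dot u v.
Proof. by rewrite dot_Jl JK dotNr opprK. Qed.

Lemma dotuJu u : dot u (J u) = 0.
Proof.
have /eqP : dot u (J u) = - dot u (J u) by rewrite {1}dotC dot_Jl.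
by rewrite -addr_eq0 -mulr2n mulrn_eq0 => /eqP.
Qed.

Lemma dotE u v : dot u v = \sum_i u 0 i * v 0 i.
Proof. by rewrite /dot mxE; apply: eq_bigr => i _; rewrite mxE. Qed.

End Dot.

(** * Directional derivatives, Schwarz's theorem and implicit curves *)

Section Calculus.
Variables (R : realType) (N : nat).
Local Notation V := 'rV[R]_N.

Lemma differentiable_linear_form (c : 'I_N -> R) (p : V) :
  differentiable (fun q : V => \sum_i c i * q 0 i) p.
Proof.
have -> : (fun q : V => \sum_i c i * q 0 i) =
    \sum_i (c i *: (fun q : V => q 0 i : R)).
  apply/funext => q; rewrite fct_sumE; apply: eq_bigr => i _.
  by [].
apply: differentiable_sum => i; apply: differentiableZ.
exact: differentiable_coord.
Qed.

Lemma differentiable_coords (Y : V -> V) (p : V) :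
  (forall i, differentiable (fun q => Y q 0 i) p) -> differentiable Y p.
Proof.
move=> dY.
have -> : Y = \sum_i (fun q => Y q 0 i *: delta_mx 0 i).
  apply/funext => q; rewrite fct_sumE; exact: row_sum_delta.
apply: differentiable_sum => i; exact: differentiableZl.
Qed.

End Calculus.

Section Generic.
Variables (R : realType) (V : normedModType R).
Implicit Types (f : V -> R) (p v : V).

Lemma derive_near0 f p v :
  (\forall h \near (0 : R), f (h *: v + p) = f p) -> 'D_v f p = 0.
Proof.
move=> fE; apply: norm_lim_near_cst => /=.
apply: nbhs_dnbhs; near=> h.
have -> : f (h *: v + p) = f p by near: h.
by rewrite subrr scaler0.
Unshelve. all: by end_near. Qed.

(** Differentiability with explicit constants, the differential being expressed
    by directional derivatives. *)
Lemma diff_eps f p : differentiable f p -> forall e, 0 < e -> exists2 d : R,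
  0 < d & forall h, `|h| < d -> `|f (p + h) - f p - 'D_h f p| <= e * `|h|.
Proof.
move=> df e e0.
have /eqaddoP /(_ e e0) := diff_locally df.
move=> /nbhs_norm0P[d d0 H]; exists d => // h hd.
have := H h hd; rewrite /= deriveE // [p + h]addrC.
by rewrite -[(_ - _) h]/(f (h + p) - (f p + 'd f p h)) opprD addrA.
Qed.

Lemma deriveDr f p (a : R) u v : differentiable f p ->
  'D_(a *: u + v) f p = a * 'D_u f p + 'D_v f p.
Proof. by move=> df; rewrite !deriveE // linearP. Qed.

Lemma deriveZr f p (a : R) u : differentiable f p ->
  'D_(a *: u) f p = a * 'D_u f p.
Proof. by move=> df; rewrite !deriveE // linearZ. Qed.

End Generic.

Section Schwarz.
Variables (R : realType) (V : normedModType R).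
Implicit Types (f : V -> R) (p q u v : V).

Lemma is_derive_line f u q (t : R) : differentiable f (q + t *: u) ->
  is_derive t 1 (fun s => f (q + s *: u)) ('D_u f (q + t *: u)).
Proof.
move=> df.
have dl : is_diff t (fun s : R => q + s *: u) (fun s => s *: u).
  have -> : (fun s : R => q + s *: u) = cst q + *:%R ^~ u by [].
  apply: is_diff_eq; apply/funext => s; exact: add0r.
have dc : differentiable (f \o (fun s : R => q + s *: u)) t.
  by apply: differentiable_comp => //; exact: ex_diff.
apply: DeriveDef; first exact: diff_derivable.
rewrite [LHS](_ : _ = 'D_1 (f \o (fun s : R => q + s *: u)) t) //.
rewrite deriveE // diff_comp //=.
by rewrite (@diff_val _ _ _ _ _ _ _ dl) scale1r deriveE.
Qed.

Lemma near_box p u v (U : set V) : nbhs p U ->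
  exists2 d : R, 0 < d & forall a b : R, `|a| < d -> `|b| < d ->
    U (p + a *: u + b *: v).
Proof.
move=> /nbhs_ballP[e /= e0 eU].
pose c := `|u| + `|v| + 1.
have c0 : 0 < c by rewrite /c; have := normr_ge0 u; have := normr_ge0 v; lra.
exists (e / c); first exact: divr_gt0.
move=> a b ad bd; apply: eU; rewrite -ball_normE /=.
rewrite -addrA opprD addrA subrr sub0r normrN.
apply: (le_lt_trans (ler_normD _ _)); rewrite !normrZ.
have e1 : e = e / c * c by rewrite divfK // gt_eqF.
have := normr_ge0 u; have := normr_ge0 v; move: ad bd => /ltW ad /ltW bd v0 u0.
have k0 : 0 < e / c by exact: divr_gt0.
rewrite [ltRHS]e1 {2}/c.
have h1 := ler_wpM2r u0 ad; have h2 := ler_wpM2r v0 bd.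
by rewrite !mulrDr mulr1 -addrA ler_ltD // ltr_pwDr.
Qed.

(** For fixed h, the second difference is the increment over [0, h] of
    s |-> f (p + h v + s u) - f (p + s u).  The mean value theorem turns it into
    h times an increment of the derivative of f along u, which the
    differentiability of that derivative at p estimates. *)
Lemma second_difference f p u v : (\forall q \near p, differentiable f q) ->
  differentiable ('D_u f) p -> forall e : R, 0 < e -> exists2 d : R, 0 < d &
    forall h : R, 0 < h -> h < d ->
    `| f (p + h *: u + h *: v) - f (p + h *: u) - f (p + h *: v) + f p
       - h ^+ 2 * 'D_v ('D_u f) p | <= e * h ^+ 2.
Proof.
move=> /(near_box u v)[d1 d10 fU] dG e e0.
pose c := 2 * `|u| + `|v| + 1.
have u0 := normr_ge0 u; have v0 := normr_ge0 v.
have c0 : 0 < c by rewrite /c; lra.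
have [d2 d20 HG] := diff_eps dG (divr_gt0 e0 c0).
have [d3 d30 GB] := near_box u v (nbhsx_ballx p d2 d20).
exists (Num.min d1 d3); first by rewrite lt_min d10.
move=> h h0; rewrite lt_min => /andP[h1 h3].
pose g (s : R) := f (p + h *: v + s *: u) - f (p + s *: u).
pose dg (s : R) := 'D_u f (p + h *: v + s *: u) - 'D_u f (p + s *: u).
have absb (d s : R) : 0 <= s -> s <= h -> h < d -> `|s| < d.
  by move=> s0 sh hd; rewrite ger0_norm // (le_lt_trans sh).
have dgP s : 0 <= s -> s <= h -> is_derive s 1 g (dg s).
  move=> s0 sh; apply: is_deriveB; apply: is_derive_line.
    rewrite addrAC; apply: fU; first exact: absb.
    by apply: absb => //; exact: ltW.
  have := fU s 0 (absb _ _ s0 sh h1); rewrite scale0r addr0; apply.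
  by rewrite normr0.
have [s] : exists2 s, s \in `]0, h[%R & g h - g 0 = dg s * (h - 0).
  apply: MVT => //.
    by move=> s; rewrite in_itv /= => /andP[/ltW s0 /ltW sh]; exact: dgP.
  apply: derivable_within_continuous => s.
  by rewrite in_itv /= => /andP[s0 sh]; have [] := dgP s s0 sh.
rewrite in_itv /= subr0 => /andP[/ltW s0 /ltW sh] gE.
have -> : f (p + h *: u + h *: v) - f (p + h *: u) - f (p + h *: v) + f p
    = dg s * h.
  rewrite -gE /g scale0r !addr0 [p + h *: v + _]addrAC; ring.
have hh : 0 <= h by exact: ltW.
have bsmall w : ball p d2 (p + w) -> `|w| < d2.
  by rewrite -ball_normE /= opprD addrA subrr sub0r normrN.
have B1 : `|s *: u + h *: v| < d2.
  apply: bsmall; rewrite addrA; apply: GB; exact: absb.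
have B2 : `|s *: u| < d2.
  apply: bsmall; rewrite -[_ + _]addr0 -(scale0r v); apply: GB.
    exact: absb.
  by rewrite normr0.
have /= E1 := HG _ B1; have /= E2 := HG _ B2.
rewrite deriveDr // !deriveZr // in E1; rewrite deriveZr // in E2.
set Gv := 'D_v ('D_u f) p in E1 *; set Gu := 'D_u ('D_u f) p in E1 E2.
have n1 : `|s *: u + h *: v| <= h * (`|u| + `|v|).
  rewrite mulrDr (le_trans (ler_normD _ _)) // !normrZ !ger0_norm //.
  by rewrite lerD // ler_wpM2r.
have n2 : `|s *: u| <= h * `|u| by rewrite normrZ ger0_norm // ler_wpM2r.
have ec : 0 <= e / c by rewrite ltW // divr_gt0.
have {}E1 := le_trans E1 (ler_wpM2l ec n1).
have {}E2 := le_trans E2 (ler_wpM2l ec n2).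
have E3 : `|dg s - h * Gv| <= e * h.
  have -> : dg s - h * Gv = ('D_u f (p + (s *: u + h *: v)) - 'D_u f p - (s * Gu + h * Gv))
      - ('D_u f (p + s *: u) - 'D_u f p - s * Gu).
    by rewrite /dg [p + h *: v + _]addrAC -[p + s *: u + _]addrA; ring.
  rewrite (le_trans (ler_normB _ _)) // (le_trans (lerD E1 E2)) //.
  rewrite -mulrDr -mulrDr [e * h]mulrC mulrCA ler_wpM2l //.
  rewrite mulrAC ler_pdivrMr // ler_wpM2l ?(ltW e0) // /c; lra.
have -> : dg s * h - h ^+ 2 * Gv = (dg s - h * Gv) * h by ring.
by rewrite normrM (ger0_norm hh) expr2 mulrA ler_wpM2r.
Qed.

(** The second difference is symmetric in u and v, so both iterated derivatives
    are its limit after division by h^2. *)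
Lemma schwarz f p u v : (\forall q \near p, differentiable f q) ->
  differentiable ('D_u f) p -> differentiable ('D_v f) p ->
  'D_v ('D_u f) p = 'D_u ('D_v f) p.
Proof.
move=> df du dv; apply/eqP; rewrite -subr_eq0 -normr_eq0; apply/eqP.
apply/le_anti; rewrite normr_ge0 andbT; apply/ler_addgt0Pr => e e0.
rewrite add0r.
have e2 : 0 < e / 2 by rewrite divr_gt0.
have [d1 d10 H1] := second_difference v df du e2.
have [d2 d20 H2] := second_difference u df dv e2.
pose h := Num.min d1 d2 / 2.
have m0 : 0 < Num.min d1 d2 by rewrite lt_min d10.
have h0 : 0 < h by rewrite divr_gt0.
have : h < Num.min d1 d2 by rewrite /h; lra.
rewrite lt_min => /andP[/(H1 h h0) {}H1 /(H2 h h0) {}H2].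
have h2 : 0 < h ^+ 2 by rewrite exprn_gt0.
rewrite -(ler_pM2l h2) -{1}(gtr0_norm h2) -normrM.
set a := 'D_v ('D_u f) p in H1 *; set b := 'D_u ('D_v f) p in H2 *.
rewrite [p + h *: v + h *: u]addrAC in H2.
move: H1 H2; set x := f _; set y := f _; set z := f _; set w := f _ => H1 H2.
have -> : h ^+ 2 * (a - b) = (x - z - y + w - h ^+ 2 * b) - (x - y - z + w - h ^+ 2 * a) by ring.
rewrite (le_trans (ler_normB _ _)) // (le_trans (lerD H2 H1)) //.
by rewrite -mulrDl -splitr mulrC.
Qed.

End Schwarz.

Section ImplicitCurve.
Variables (R : realType) (V : normedModType R).
Implicit Types (f : V -> R) (p q X v : V).

(** If f has slope 0 along X and 1 along v, then f (p + t X + s v) is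
    nonnegative at s = e |t| and nonpositive at s = - e |t| as soon as t is small,
    and the intermediate value theorem applies. *)
Lemma zero_in_cone f p X v : (\forall q \near p, differentiable f q) ->
  f p = 0 -> 'D_X f p = 0 -> 'D_v f p = 1 ->
  forall e : R, 0 < e -> exists2 d : R, 0 < d &
    forall t : R, `|t| < d ->
      exists2 s : R, f (p + t *: X + s *: v) = 0 & `|s| <= e * `|t|.
Proof.
move=> df fp DX Dv e e0.
have dfp : differentiable f p := nbhs_singleton df.
pose c := `|X| + e * `|v| + 1.
have X0 := normr_ge0 X; have v0 := mulr_ge0 (ltW e0) (normr_ge0 v).
have c0 : 0 < c by rewrite /c; lra.
have [d1 d10 H] := diff_eps dfp (divr_gt0 e0 c0).
have [d2 d20 fU] := near_box X v df.
exists (Num.min d2 (Num.min (d2 / e) (d1 / c))).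
  by rewrite !lt_min d20 !divr_gt0.
move=> t; rewrite !lt_min => /and3P[td2 tde tdc].
have t0 := normr_ge0 t.
have et0 : 0 <= e * `|t| by rewrite mulr_ge0 // ltW.
pose g (s : R) := f (p + t *: X + s *: v).
have key s : `|s| = e * `|t| -> `|g s - s| <= `|s|.
  move=> sE.
  have hn : `|t *: X + s *: v| <= `|t| * (`|X| + e * `|v|).
    by rewrite (le_trans (ler_normD _ _)) // !normrZ sE mulrDr lerD // mulrA [`|t| * e]mulrC.
  have hlt : `|t *: X + s *: v| < d1.
    apply: (le_lt_trans hn); apply: (@le_lt_trans _ _ (`|t| * c)).
      by rewrite ler_wpM2l // /c; lra.
    by rewrite -ltr_pdivlMr.
  have := H _ hlt; rewrite fp subr0 addrA -/(g s).
  rewrite deriveDr // deriveZr // DX Dv mulr0 add0r mulr1 => /le_trans; apply.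
  have ec : 0 <= e / c by rewrite ltW // divr_gt0.
  apply: (le_trans (ler_wpM2l ec hn)).
  rewrite mulrAC ler_pdivrMr // sE mulrA ler_wpM2l // /c; lra.
have [s sab gs] : exists2 s, s \in `[- (e * `|t|), e * `|t|] & g s = 0.
  apply: IVT.
  - lra.
  - apply: derivable_within_continuous => s; rewrite in_itv /= => sab.
    have [] // : is_derive s 1 g ('D_v f (p + t *: X + s *: v)).
    apply: is_derive_line; apply: fU => //.
    have : `|s| <= e * `|t| by rewrite ler_norml.
    by move=> /le_lt_trans; apply; rewrite mulrC -ltr_pdivlMr.
  - have := key (e * `|t|); rewrite ger0_norm // => /(_ erefl) k1.
    have := key (- (e * `|t|)); rewrite normrN ger0_norm // => /(_ erefl) k2.
    rewrite ge_min le_max; move: k1 k2; rewrite !ler_norml.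
    move=> /andP[k1 _] /andP[_ k2]; apply/andP; split; apply/orP; [left|right]; lra.
by exists s => //; rewrite ler_norml; move: sab; rewrite in_itv.
Qed.

(** The part of the implicit function theorem needed to find curves in a level
    set: the curve is p + t X + s(t) v, where s(t) is a zero of
    s |-> f (p + t X + s v) whose absolute value is minimal up to t^2.  Such a
    choice is o(t) by zero_in_cone. *)
Lemma implicit_curve f p X v : (\forall q \near p, differentiable f q) ->
  f p = 0 -> 'D_X f p = 0 -> 'D_v f p != 0 ->
  exists c : R -> V, [/\ c 0 = p, is_derive (0 : R) 1 c X &
    \forall t \near (0 : R), f (c t) = 0].
Proof.
move=> df fp DX; set a := 'D_v f p => a0.
have dfp : differentiable f p := nbhs_singleton df.
have {a0} : 'D_(a^-1 *: v) f p = 1 by rewrite deriveZr // mulVf.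
move: {v a}(a^-1 *: v) => v Dv.
have ZC := zero_in_cone df fp DX Dv.
pose Z (t s : R) := f (p + t *: X + s *: v) = 0.
have [s sP] : exists s : R -> R, forall t s', Z t s' ->
    Z t (s t) /\ `|s t| <= `|s'| + t ^+ 2.
  suff /boolp.choice[s sP] : forall t, exists st, forall s', Z t s' ->
      Z t st /\ `|st| <= `|s'| + t ^+ 2 by exists s.
  move=> t.
  have [->|t0] := eqVneq t 0.
    by exists 0 => s' _; rewrite /Z !scale0r !addr0 fp normr0 expr0n addr0 normr_ge0.
  have [[s0 Zs0]|nZ] := pselect (exists s, Z t s); last first.
    by exists 0 => s' Zs'; exfalso; apply: nZ; exists s'.
  have hinf : has_inf [set `|s| | s in Z t].
    split; first by exists `|s0|, s0.
    by exists 0 => _ [s _ <-]; exact: normr_ge0.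
  have t2 : 0 < t ^+ 2 by rewrite exprn_even_gt0.
  have [_ [s Zs <-] sle] := inf_adherent t2 hinf.
  exists s => s' Zs'; split=> //; apply: (le_trans (ltW sle)).
  by rewrite lerD2r; apply: ge_inf; [exact: hinf.2|exists s'].
have s0 : s 0 = 0.
  have [|_] := sP 0 0; first by rewrite /Z !scale0r !addr0.
  by rewrite normr0 expr0n addr0 normr_le0 => /eqP.
exists (fun t => p + t *: X + s t *: v); split.
- by rewrite s0 !scale0r !addr0.
- have cv : (fun h : R => h^-1 *: ((p + h *: X + s h *: v) - p) : V) @ (0 : R)^' --> X.
    apply/cvgrPdist_le => /= e e0.
    pose e' := e / (2 * (`|v| + 1)).
    have v0 := normr_ge0 v.
    have v1 : 0 < 2 * (`|v| + 1) by lra.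
    have e'0 : 0 < e' by exact: divr_gt0.
    have [d d0 dP] := ZC _ e'0.
    have nz : \forall h \near (0 : R)^', h != 0 by exact: nbhs_dnbhs_neq.
    near=> h.
    have h0 : h != 0 by near: h.
    have hd : `|h| < d by near: h; apply: dnbhs0_lt.
    have he : `|h| < e' by near: h; apply: dnbhs0_lt.
    rewrite [X in h^-1 *: X](_ : _ = h *: X + s h *: v); last first.
      by rewrite -[p + _ + _]addrA addrAC subrr add0r.
    rewrite scalerDr !scalerA mulVf // scale1r opprD addrA subrr sub0r normrN.
    have [s' Zs' s'le] := dP h hd.
    have [_ shle] := sP _ _ Zs'.
    rewrite normrZ normrM normfV.
    have hp : 0 < `|h| by rewrite normr_gt0.
    have shle' : `|h|^-1 * `|s h| <= 2 * e'.
      rewrite mulrC ler_pdivrMr // (le_trans shle) //.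
      have -> : h ^+ 2 = `|h| ^+ 2 by rewrite real_normK // num_real.
      have := ler_wpM2r (ltW hp) (ltW he); rewrite -expr2; lra.
    apply: (le_trans (ler_wpM2r v0 shle')).
    have -> : e = 2 * e' * (`|v| + 1).
      by rewrite mulrAC mulrC /e' divfK // gt_eqF.
    by rewrite ler_wpM2l // ?lerDl // mulr_ge0 // ltW.
  have E : (fun h : R => h^-1 *: (((fun t => p + t *: X + s t *: v) \o shift 0)
      (h *: (1 : R)) - (p + 0 *: X + s 0 *: v)) : V) =
      (fun h : R => h^-1 *: ((p + h *: X + s h *: v) - p) : V).
    by apply/funext => h; rewrite /= s0 !scale0r !addr0 [h *: 1]mulr1.
  rewrite -E in cv.
  apply: DeriveDef; first by apply/cvg_ex; exists X; exact: cv.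
  by apply: cvg_lim => //; exact: cv.
- have [d d0 dP] := ZC _ ltr01.
  apply/nbhs_norm0P; exists d => // t td.
  by have [s' Zs' _] := dP t td; have [] := sP _ _ Zs'.
Unshelve. all: by end_near. Qed.

Lemma derive_curve f p X (c : R -> V) : differentiable f p -> c 0 = p ->
  is_derive (0 : R) 1 c X -> (\forall t \near (0 : R), f (c t) = 0) ->
  'D_X f p = 0.
Proof.
move=> df c0 [dc cX] fc.
have dc' : differentiable c 0 by apply/derivable1_diffP.
have df' : differentiable f (c 0) by rewrite c0.
have E : 'D_1 (f \o c) 0 = 'D_X f p.
  rewrite deriveE; last exact: differentiable_comp.
  have dcX : 'd c 0 1 = X by rewrite -cX deriveE.
  by rewrite diff_comp //= dcX c0 deriveE.
rewrite -E (@near_eq_derive _ _ _ (f \o c) (cst (0 : R)) _ _ fc).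
exact: derive_cst.
Qed.

End ImplicitCurve.

Section Pointwise.
Variables (R : realType) (V : normedModType R).
Implicit Types (f g : V -> R) (p v : V).

Lemma diff_mul f g p : differentiable f p -> differentiable g p ->
  differentiable (fun q => f q * g q) p.
Proof. exact: differentiableM. Qed.

Lemma diff_sub f g p : differentiable f p -> differentiable g p ->
  differentiable (fun q => f q - g q) p.
Proof. exact: differentiableB. Qed.

Lemma derive_mul f g p v : differentiable f p -> differentiable g p ->
  'D_v (fun q => f q * g q) p = f p * 'D_v g p + g p * 'D_v f p.
Proof.
by move=> df dg; apply: (@deriveM _ _ f g p v); exact: diff_derivable.
Qed.

Lemma derive_sub f g p v : differentiable f p -> differentiable g p ->
  'D_v (fun q => f q - g q) p = 'D_v f p - 'D_v g p.
Proof.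
by move=> df dg; apply: (@deriveB _ _ _ f g p v); exact: diff_derivable.
Qed.

End Pointwise.

(** * Tangent space and second fundamental form of a hypersurface *)

Section Hypersurface.
Variables (R : realType) (n : nat).
Local Notation V := (cspace R n).
Implicit Types (p u v X Y : V).

Definition coords_diff (Z : V -> V) p : Prop :=
  forall i, differentiable (fun q => Z q 0 i) p.

Lemma coords_diff_id p : coords_diff id p.
Proof. by move=> i; exact: differentiable_coord. Qed.

Lemma coords_diff_cst u p : coords_diff (fun=> u) p.
Proof. by move=> i; exact: differentiable_cst. Qed.

Lemma coords_diff_J p : coords_diff (@J R n) p.
Proof.
move=> i; rewrite (_ : (fun q => _) = fun q : V => \sum_j Jmx R n j i * q 0 j).
  exact: differentiable_linear_form.
by apply/funext => q; rewrite JE mxE; apply: eq_bigr => j _; rewrite mulrC.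
Qed.

Lemma coords_diff_scale (a : V -> R) (Z : V -> V) p : differentiable a p ->
  coords_diff Z p -> coords_diff (fun q => a q *: Z q) p.
Proof.
move=> da dZ i; rewrite (_ : (fun q => _) = fun q => a q * Z q 0 i).
  exact: diff_mul.
by apply/funext => q; rewrite mxE.
Qed.

Lemma coords_diff_sub (Z Z' : V -> V) p : coords_diff Z p ->
  coords_diff Z' p -> coords_diff (fun q => Z q - Z' q) p.
Proof.
move=> dZ dZ' i; rewrite (_ : (fun q => _) = fun q => Z q 0 i - Z' q 0 i).
  exact: diff_sub.
by apply/funext => q; rewrite !mxE.
Qed.

Lemma diff_dot (Z Z' : V -> V) p : coords_diff Z p -> coords_diff Z' p ->
  differentiable (fun q => dot (Z q) (Z' q)) p.
Proof.
move=> dZ dZ'.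
rewrite (_ : (fun q => _) = \sum_i (fun q => Z q 0 i * Z' q 0 i)).
  by apply: differentiable_sum => i; exact: diff_mul.
by apply/funext => q; rewrite fct_sumE dotE.
Qed.

Lemma derive_dot (Y : V -> V) p v u : differentiable Y p ->
  dot ('D_v Y p) u = 'D_v (fun q => dot (Y q) u) p.
Proof.
move=> dY.
have dYi i : derivable (fun q => Y q 0 i) p v.
  apply: diff_derivable.
  apply: (@differentiable_comp _ _ _ _ Y (fun q : V => q 0 i : R)) => //.
  exact: differentiable_coord.
have dYu i : derivable (fun q => u 0 i * Y q 0 i) p v.
  by apply: (@derivableZ _ _ _ (fun q => Y q 0 i)).
rewrite dotE derive_mx; last exact: diff_derivable.
rewrite (_ : (fun q => _) = \sum_i (fun q => u 0 i * Y q 0 i)); last first.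
  by apply/funext => q; rewrite fct_sumE dotE; apply: eq_bigr => i _; rewrite mulrC.
rewrite derive_sum //; apply: eq_bigr => i _; rewrite mxE mulrC.
by rewrite (@deriveZ _ _ _ (fun q => Y q 0 i) (u 0 i)).
Qed.

(** The orthogonal projection to the horizontal space at p, multiplied by the
    square norm of p: this avoids a division and makes it polynomial in p. *)
Definition hproj p u : V := dot p p *: u - dot u p *: p - dot u (J p) *: J p.

Lemma hproj_horizontal p u : horizontal p (hproj p u).
Proof.
rewrite /hproj /horizontal !dotBl !dotZl dotJJ dotuJu [dot (J p) p]dotC dotuJu.
by split; ring.
Qed.

Lemma horizontal_lin p u v (a : R) : horizontal p u -> horizontal p v ->
  horizontal p (a *: u + v).
Proof.
by move=> [u1 u2] [v1 v2]; rewrite /horizontal !dotDl !dotZl u1 u2 v1 v2 mulr0 addr0.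
Qed.

Section Local.
Variables (M : set V) (U : set V) (F : V -> R).
Hypotheses (projM : projective_set M) (oU : open U).
Hypotheses (dF : forall p, U p -> differentiable F p).
Hypotheses (MF : forall p, U p -> (M p <-> F p = 0)).

Lemma near_mul p (P : set V) v : nbhs p P -> \forall h \near (0 : R), P (h *: v + p).
Proof.
move=> /(near_box v v)[d d0 H]; apply/nbhs_norm0P; exists d => // h /= hd.
by have := H h 0 hd; rewrite scale0r addr0 addrC; apply; rewrite normr0.
Qed.

(** M is a complex cone, so F vanishes along the curves p + h p and p + h J p. *)
Lemma derive_cone p : U p -> M p -> 'D_p F p = 0 /\ 'D_(J p) F p = 0.
Proof.
move=> Up Mp; have Fp := (MF Up).1 Mp; have nU := open_nbhs_nbhs (conj oU Up).
have H1 : \forall h \near (0 : R), `|h| < 1 by apply/nbhs_norm0P; exists 1 => //=; exact: ltr01.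
split; apply: derive_near0; rewrite Fp.
  near=> h.
  have Uh : U (h *: p + p) by near: h; exact: near_mul.
  have h1 : `|h| < 1 by near: h; exact: H1.
  apply/(MF Uh).
  have -> : h *: p + p = (h + 1) *: p + 0 *: J p.
    by rewrite scale0r addr0 scalerDl scale1r.
  apply: projM.2 => //; apply/eqP => -[] h0.
  by move: h1; rewrite ltr_norml; lra.
near=> h.
have Uh : U (h *: J p + p) by near: h; exact: near_mul.
apply/(MF Uh); rewrite addrC -{1}[p]scale1r.
by apply: projM.2 => //; apply/eqP => -[] /eqP; rewrite oner_eq0.
Unshelve. all: by end_near. Qed.

Lemma tangent_level_set p X v : U p -> M p -> 'D_v F p != 0 ->
  tangent M p X <-> horizontal p X /\ 'D_X F p = 0.
Proof.
move=> Up Mp Dv; have Fp := (MF Up).1 Mp.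
have nU := open_nbhs_nbhs (conj oU Up).
have cU (c : R -> V) : c 0 = p -> is_derive (0 : R) 1 c X ->
    \forall t \near (0 : R), U (c t).
  move=> c0 [dc _].
  have /differentiable_continuous : differentiable c 0 by apply/derivable1_diffP.
  by apply; rewrite c0.
split.
  move=> [hX [c [c0 cX Mc]]]; split=> //.
  apply: (derive_curve (dF Up) c0 cX).
  have Uc := cU c c0 cX.
  by near=> t; apply/(MF _); near: t.
move=> [hX DX]; split=> //.
have ndF : \forall q \near p, differentiable F q.
  by near=> q; apply: dF; near: q.
have [c [c0 cX Fc]] := implicit_curve ndF Fp DX Dv.
exists c; split=> //; have Uc := cU c c0 cX.
by near=> t; apply/MF; near: t.
Unshelve. all: by end_near. Qed.

End Local.
End Hypersurface.

Section SecondForm.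
Variables (R : realType) (n : nat).
Local Notation V := (cspace R n).
Implicit Types (p u v X Y : V).

Lemma linear_coord_sum (g : V -> R) :
  (forall (a : R) u v, g (a *: u + v) = a * g u + g v) ->
  forall X, g X = \sum_i X 0 i * g (delta_mx 0 i).
Proof.
move=> gl X; rewrite {1}(row_sum_delta X).
have g0 : g 0 = 0.
  have := gl (-1) 0 0; rewrite scaler0 addr0 mulN1r => /eqP.
  by rewrite -subr_eq0 addrC => /eqP; lra.
elim/big_rec2: _ => // i a b _ <-.
exact: gl.
Qed.

Variables (M : set V) (m nu : V) (A : V -> V -> R).
Hypotheses (hM : hypersurface M) (Mm : M m) (mm : dot m m = 1).
Hypotheses (hnu : unit_normal M m nu) (hA : second_fundamental_form M m nu A).

(** The unit normal cannot be tangent, so F has a nonzero derivative along nu.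
    Hence a horizontal vector orthogonal to nu is tangent: correcting it by a
    multiple of nu gives a tangent vector, whose product with nu vanishes, and
    this product is the multiple. *)
Lemma local_equation : exists (U : set V) (F : V -> R),
  [/\ [/\ open U, U m & forall p, U p -> (M p <-> F p = 0)],
      forall p, U p -> differentiable F p,
      forall v p, U p -> differentiable ('D_v F) p,
      'D_nu F m != 0 &
      forall X, tangent M m X <-> horizontal m X /\ dot X nu = 0].
Proof.
have [projM hyp] := hM.
have [U [F [oU Um sF MF Dv0]]] := hyp m Mm; have [v Dv] := Dv0 m Um Mm.
exists U, F; have [dF d2] := sF 2%N.
have d2F w p : U p -> differentiable ('D_w F) p by move=> Up; exact: (d2 w).1.
have T X := tangent_level_set oU dF MF X Um Mm Dv.
have [hn nn nT] := hnu.
have Dnu : 'D_nu F m != 0.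
  apply/eqP => D0; have /nT : tangent M m nu by apply/T.
  by move/eqP; rewrite nn oner_eq0.
split=> // X; split=> [tX|[hX Xn]]; first by split; [case: tX|exact: nT].
apply/T; split=> //.
pose a := 'D_X F m / 'D_nu F m.
have /nT : tangent M m ((- a) *: nu + X).
  apply/T; split; first exact: horizontal_lin.
  rewrite deriveDr; last exact: dF.
  by rewrite mulNr divfK // addNr.
rewrite dotDl dotZl nn Xn mulr1 addr0 => /eqP; rewrite oppr_eq0 mulf_eq0.
by rewrite invr_eq0 (negbTE Dnu) orbF => /eqP.
Qed.

Lemma tangent_unitP X : tangent M m X <-> horizontal m X /\ dot X nu = 0.
Proof. by have [U [F []]] := local_equation. Qed.

(** The second fundamental form is the normalised Hessian of F.  A tangent vector
    Y at m is extended by the field Z, a combination of the horizontal projections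
    of Y and nu with coefficients the derivatives of F along nu and Y: it is
    horizontal, and it kills F because the derivative of F along a horizontal
    projection is a multiple of that along the vector itself (see derive_cone).
    In the derivative of Z paired with nu, every term but one is a product of two
    factors vanishing at m. *)
Lemma sff_hessian (U : set V) (F : V -> R) :
  open U -> U m -> (forall p, U p -> (M p <-> F p = 0)) ->
  (forall p, U p -> differentiable F p) ->
  (forall v p, U p -> differentiable ('D_v F) p) -> 'D_nu F m != 0 ->
  forall X Y, tangent M m X -> tangent M m Y ->
    A X Y = - ('D_nu F m)^-1 * 'D_X ('D_Y F) m.
Proof.
move=> oU Um MF dF d2F; set c := 'D_nu F m => c0 X Y tX tY.
have [projM _] := hM.
have nU : \forall p \near m, U p by exact: open_nbhs_nbhs.
have [hn nn nT] := hnu.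
have DY : 'D_Y F m = 0 by have [] := (tangent_level_set oU dF MF Y Um Mm c0).1 tY.
have Yn : dot Y nu = 0 by exact: nT.
have [[Ym YJm] _] := tY.
have [nm nJm] := hn.
pose Z p : V := c^-1 *: ('D_nu F p *: hproj p Y - 'D_Y F p *: hproj p nu).
have dh p u : coords_diff (fun q => hproj q u) p.
  rewrite /hproj.
  have i1 : coords_diff (fun q : V => q) p by exact: coords_diff_id.
  have i2 : coords_diff (fun q : V => J q) p by exact: coords_diff_J.
  have i3 : coords_diff (fun q : V => u) p by exact: coords_diff_cst.
  by apply: coords_diff_sub; [apply: coords_diff_sub|];
    apply: coords_diff_scale => //; exact: diff_dot.
have dZ : differentiable Z m.
  apply: differentiable_coords; apply: coords_diff_scale.
    exact: differentiable_cst.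
  by apply: coords_diff_sub; apply: coords_diff_scale => //; exact: d2F.
have Zm : Z m = Y.
  rewrite /Z DY scale0r subr0 -/c scalerA mulVf // scale1r.
  by rewrite /hproj mm Ym YJm !scale0r !subr0 scale1r.
have nc : \forall p \near m, 'D_nu F p != 0.
  have /differentiable_continuous cD := d2F nu m Um.
  have /cD : nbhs ('D_nu F m) [set x : R | x != 0].
    by apply: open_nbhs_nbhs; split=> //; exact: open_neq.
  by [].
have tZ : \forall p \near m, M p -> tangent M p (Z p).
  near=> p => Mp.
  have Up : U p by near: p.
  have c'0 : 'D_nu F p != 0 by near: p.
  apply/(tangent_level_set oU dF MF _ Up Mp c'0).
  have [h1 h2] := hproj_horizontal p Y; have [h3 h4] := hproj_horizontal p nu.
  split.
    by split; rewrite dotZl dotBl !dotZl ?h1 ?h2 ?h3 ?h4; ring.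
  have [Dp DJp] := derive_cone projM oU MF Up Mp.
  have dFp := dF p Up.
  have Dh u : 'D_(hproj p u) F p = dot p p * 'D_u F p.
    have -> : hproj p u = dot p p *: u + (- dot u p *: p + - dot u (J p) *: J p).
      by rewrite /hproj !scaleNr addrA.
    by rewrite deriveDr // deriveDr // deriveZr // Dp DJp; ring.
  rewrite /Z.
  have -> : 'D_nu F p *: hproj p Y - 'D_Y F p *: hproj p nu =
     'D_nu F p *: hproj p Y + - 'D_Y F p *: hproj p nu by rewrite scaleNr.
  by rewrite deriveZr // deriveDr // deriveZr // !Dh; ring.
have := hA tX dZ tZ; rewrite Zm => ->.
rewrite /nabla !dotBl !dotZl [dot m nu]dotC nm [dot (J m) nu]dotC nJm.
rewrite !mulr0 !subr0 derive_dot //.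
pose al p := dot (hproj p Y) nu; pose be p := dot (hproj p nu) nu.
have dal : differentiable al m by apply: diff_dot => //; exact: coords_diff_cst.
have dbe : differentiable be m by apply: diff_dot => //; exact: coords_diff_cst.
rewrite (_ : (fun q => _) = fun q => c^-1 * ('D_nu F q * al q - 'D_Y F q * be q)); last first.
  by apply/funext => q; rewrite /Z dotZl dotBl !dotZl.
have dn := d2F nu m Um; have dy := d2F Y m Um.
have dcst : differentiable (fun _ : V => c^-1 : R) m by exact: differentiable_cst.
rewrite derive_mul //; last by apply: diff_sub; exact: diff_mul.
rewrite derive_sub; [|exact: diff_mul|exact: diff_mul].
rewrite !derive_mul //.
have -> : 'D_X (fun _ : V => c^-1 : R) m = 0 by exact: derive_cst.
have alm : al m = 0.
  by rewrite /al /hproj Ym YJm !scale0r !subr0 dotZl Yn mulr0.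
have bem : be m = 1.
  by rewrite /be /hproj nm nJm !scale0r !subr0 dotZl nn mm mulr1.
(* al is a sum of products of pairs of functions that vanish at m *)
have Dal : 'D_X al m = 0.
  have iY : coords_diff (fun q : V => Y) m by exact: coords_diff_cst.
  have iN : coords_diff (fun q : V => nu) m by exact: coords_diff_cst.
  have i1 : coords_diff (fun q : V => q) m by exact: coords_diff_id.
  have i2 : coords_diff (fun q : V => J q) m by exact: coords_diff_J.
  have E : al = (fun q => (0 - dot Y q * dot q nu) - dot Y (J q) * dot (J q) nu).
    by apply/funext => q; rewrite /al /hproj !dotBl !dotZl Yn mulr0.
  have d1 : differentiable (fun q : V => dot Y q * dot q nu) m.
    by apply: diff_mul; exact: diff_dot.
  have d2 : differentiable (fun q : V => dot Y (J q) * dot (J q) nu) m.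
    by apply: diff_mul; exact: diff_dot.
  have d0 : differentiable (fun _ : V => 0 : R) m by exact: differentiable_cst.
  rewrite E derive_sub //; last exact: diff_sub.
  rewrite derive_sub // !derive_mul ?Ym ?YJm; try exact: diff_dot.
  rewrite [dot m nu]dotC nm [dot (J m) nu]dotC nJm.
  have -> : 'D_X (fun _ : V => 0 : R) m = 0 by exact: derive_cst.
  by rewrite !mul0r; ring.
rewrite Dal alm bem; move: DY => ->.
by rewrite !(mulr0, mul0r, mul1r, addr0, add0r, sub0r) mulrN mulNr.
Unshelve. all: by end_near. Qed.

(** Symmetry of the second fundamental form comes from Schwarz's theorem for F. *)
Lemma sff_matrix : exists2 H : 'M[R]_(n.+2 + n.+2), H^T = H &
  forall X Y, tangent M m X -> tangent M m Y -> A X Y = (X *m H *m Y^T) 0 0.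
Proof.
have [U [F [[oU Um MF] dF d2F c0 _]]] := local_equation.
have AE := sff_hessian oU Um MF dF d2F c0.
have nU : \forall p \near m, differentiable F p.
  by near=> p; apply: dF; near: p; exact: open_nbhs_nbhs.
pose c := - ('D_nu F m)^-1.
pose h X Y := 'D_X ('D_Y F) m.
have hC X Y : h X Y = h Y X.
  by apply: schwarz; [exact: nU|exact: d2F|exact: d2F].
have hl Y (a : R) u v : h (a *: u + v) Y = a * h u Y + h v Y.
  by rewrite /h deriveDr //; exact: d2F.
pose H : 'M[R]_(n.+2 + n.+2) := \matrix_(i, j) (c * h (delta_mx 0 i) (delta_mx 0 j)).
exists H; first by apply/matrixP => i j; rewrite !mxE hC.
move=> X Y tX tY; rewrite AE // -/c -/(h X Y).
have hE u Z : h u Z = \sum_i u 0 i * h (delta_mx 0 i) Z.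
  by apply: (@linear_coord_sum (h^~ Z)); exact: hl.
rewrite hE -mulmxA mxE mulr_sumr; apply: eq_bigr => i _.
rewrite hC hE mxE !mulr_sumr; apply: eq_bigr => j _.
by rewrite !mxE (hC (delta_mx 0 j)) mulrCA; congr (_ * _); rewrite mulrA mulrAC.
Unshelve. all: by end_near. Qed.

End SecondForm.

(** * Orthonormal bases and elementary symmetric functions *)

Section ElemSym.
Variable R : realType.

Lemma size_eigenvalues n (B : 'M[R]_n) s : eigenvalues B s -> size s = n.
Proof.
move=> /(congr1 (fun p : {poly R} => size p)).
by rewrite size_char_poly size_prod_XsubC => -[].
Qed.

Lemma elem_sym_coef n (B : 'M[R]_n) s i : eigenvalues B s ->
  (0 < i)%N -> (i <= n)%N ->
  elem_sym i%:Z s = (-1) ^+ i * (char_poly B)`_(n - i).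
Proof.
move=> sB i0 i_n; have sn := size_eigenvalues sB.
have le : (n - i <= size s)%N by rewrite sn leq_subr.
have ni : (size s - (n - i) = i)%N by rewrite sn subKn.
rewrite sB coef_prod_XsubC // ni mulrA -expr2 sqrr_sign mul1r.
rewrite /elem_sym lez_nat leqNgt i0 /=.
by apply: eq_bigl => I.
Qed.

End ElemSym.

Section FrameBasis.
Variables (R : realType) (n : nat).
Local Notation V := (cspace R n).
Local Notation N := (n.+2 + n.+2)%N.
Implicit Types (T : set V) (P : 'M[R]_N).

Lemma orthonormal_mx m (E : 'M[R]_(m, N)) :
  E *m E^T = 1%:M <->
  forall i j, dot (row i E) (row j E) = (i == j)%:R.
Proof.
have h i j : dot (row i E) (row j E) = (E *m E^T) i j.
  by rewrite dotE mxE; apply: eq_bigr => k _; rewrite !mxE.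
split=> [EE i j|EE]; first by rewrite h EE mxE.
by apply/matrixP => i j; rewrite -h EE mxE.
Qed.

(** Subspaces are handled through their orthogonal projectors P: an orthonormal
    basis is then a matrix E with E E^T = 1 and E^T E = P. *)
Lemma frame_basis T P m (E : 'M[R]_(m, N)) :
  (forall X, T X <-> X *m P = X) -> E *m E^T = 1%:M -> E^T *m E = P ->
  orthonormal_basis T (fun i => row i E).
Proof.
move=> TP EE EP; split.
- by move=> i; apply/TP; rewrite -row_mul -EP mulmxA EE mul1mx.
- exact/orthonormal_mx.
- move=> X /TP XP; exists (fun i => (X *m E^T) 0 i).
  by rewrite -{1}XP -EP mulmxA mulmx_sum_row.
Qed.

Lemma basis_frame T P m (e : 'I_m -> V) : P^T = P ->
  (forall X, T X <-> X *m P = X) -> (P *m P = P) -> orthonormal_basis T e ->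
  let E := \matrix_i e i in E *m E^T = 1%:M /\ E^T *m E = P.
Proof.
move=> PT TP PP [Te ee spane] E.
have EE : E *m E^T = 1%:M by apply/orthonormal_mx => i j; rewrite !rowK.
split=> //.
have EP : E *m P = E.
  by apply/row_matrixP => i; rewrite row_mul rowK; apply/TP.
have XE X : T X -> X *m (E^T *m E) = X.
  move=> /spane[a ->].
  have -> : \sum_i a i *: e i = (\row_i a i) *m E.
    by rewrite mulmx_sum_row; apply: eq_bigr => i _; rewrite mxE rowK.
  by rewrite !mulmxA -(mulmxA _ E) EE mulmx1.
have PE : P *m (E^T *m E) = P.
  apply/row_matrixP => i; rewrite row_mul; apply: XE; apply/TP.
  by rewrite -row_mul PP.
have PE' : P *m E^T = E^T by rewrite -{1}PT -trmx_mul EP.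
by rewrite -[RHS]PE mulmxA PE'.
Qed.

Lemma matrix_in_row T (A : V -> V -> R) H m (E : 'M[R]_(m, N)) :
  (forall X Y, T X -> T Y -> A X Y = (X *m H *m Y^T) 0 0) ->
  (forall i, T (row i E)) -> matrix_in A (fun i => row i E) = E *m H *m E^T.
Proof.
move=> AH TE; apply/matrixP => i j; rewrite mxE AH //.
by rewrite -row_mul !mxE; apply: eq_bigr => k _; rewrite !mxE.
Qed.

End FrameBasis.

Lemma bilinear_ext (R : comNzRingType) N (C D : 'M[R]_N) :
  (forall x y : 'rV[R]_N, (x *m C *m y^T) 0 0 = (x *m D *m y^T) 0 0) -> C = D.
Proof.
move=> h; apply/matrixP => i j; have := h (delta_mx 0 i) (delta_mx 0 j).
by rewrite -!rowE trmx_delta -!colE !mxE.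
Qed.

Lemma frame_col_mx (R : comNzRingType) N p q (E : 'M[R]_(p, N)) (G : 'M[R]_(q, N)) :
  E *m E^T = 1%:M -> G *m G^T = 1%:M -> E *m G^T = 0 ->
  col_mx E G *m (col_mx E G)^T = 1%:M.
Proof.
move=> EE GG EG; have GE : G *m E^T = 0.
  by apply: trmx_inj; rewrite trmx_mul trmxK EG trmx0.
by rewrite tr_col_mx mul_col_row EE GG EG GE -scalar_mx_block.
Qed.

(** The value of an elementary symmetric function of a form does not depend on
    the orthonormal basis in which it is computed, so one basis E serves for all
    degrees. *)
Lemma form_elem_sym_coef (R : realType) (n : nat) (T : set (cspace R n))
    (P H : 'M[R]_(n.+2 + n.+2)) A p (E : 'M[R]_(p, n.+2 + n.+2)) i x :
  P^T = P -> (forall X, T X <-> X *m P = X) -> P *m P = P ->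
  (forall X Y, T X -> T Y -> A X Y = (X *m H *m Y^T) 0 0) ->
  E *m E^T = 1%:M -> E^T *m E = P ->
  form_elem_sym T A i%:Z x -> (0 < i)%N -> (i <= p)%N ->
  x = (-1) ^+ i * (char_poly (E *m H *m E^T))`_(p - i).
Proof.
move=> PT TP PP AH EE EP [q [e [s [eT se ->]]]] i0 ip.
have [EE' EP'] := basis_frame PT TP PP eT.
set E' := \matrix_i e i in EE' EP'.
have eE : matrix_in A e = E' *m H *m E'^T.
  rewrite -(@matrix_in_row _ _ T A) //; last by move=> j; rewrite rowK; case: eT.
  by apply/matrixP => j k; rewrite !mxE !rowK.
have [|| pq chi] := frame_change H EE EE'.
- by exists (E' *m E^T); rewrite -mulmxA EP -EP' mulmxA EE' mul1mx.
- by exists (E *m E'^T); rewrite -mulmxA EP' -EP mulmxA EE mul1mx.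
by rewrite chi -eE pq (elem_sym_coef se) // -pq.
Qed.

Lemma block_form (R : comNzRingType) N p q r s (H : 'M[R]_N)
    (X : 'M[R]_(p, N)) (Y : 'M[R]_(q, N))
    (X' : 'M[R]_(r, N)) (Y' : 'M[R]_(s, N)) :
  col_mx X Y *m H *m (col_mx X' Y')^T =
  block_mx (X *m H *m X'^T) (X *m H *m Y'^T) (Y *m H *m X'^T) (Y *m H *m Y'^T).
Proof. by rewrite mul_col_mx tr_col_mx mul_col_row. Qed.

(** * Normal forms of stark hypersurfaces *)

Section Projectors.
Variables (R : realType) (n : nat).
Local Notation V := (cspace R n).
Local Notation N := (n.+2 + n.+2)%N.
Local Notation K := (Jmx R n).
Variables (M : set V) (m nu : V).
Hypotheses (hM : hypersurface M) (Mm : M m) (mm : dot m m = 1).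
Hypotheses (hnu : unit_normal M m nu).

(** The complex span of m and nu is the orthogonal complement of the holomorphic
    distribution at m. *)
Definition normal_frame : 'M[R]_(1 + 1, N) := col_mx m nu.
Local Notation Q := normal_frame.
Local Notation Pr := (complement_proj K Q).
Local Notation w := (W nu).

Lemma dot_eq0 (x y : V) : x *m y^T = 0 <-> dot x y = 0.
Proof.
by split=> [xy|xy]; [rewrite /dot xy mxE | rewrite [LHS]mx11_scalar -/(dot x y) xy raddf0].
Qed.

Lemma dot_eq1 (x y : V) : dot x y = 1 -> x *m y^T = 1%:M.
Proof. by move=> xy; rewrite [LHS]mx11_scalar -/(dot x y) xy. Qed.

Lemma normal_totally_real : totally_real K Q.
Proof.
have [[n1 n2] nn _] := hnu.
have mn : m *m nu^T = 0 by apply/dot_eq0; rewrite dotC.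
split.
  rewrite /Q tr_col_mx mul_col_row (dot_eq1 mm) (dot_eq1 nn) mn.
  by rewrite ((dot_eq0 nu m).2 n1) -scalar_mx_block.
rewrite /Q mul_col_mx tr_col_mx mul_col_row -!JE.
have z (u : V) : J u *m u^T = 0 by apply/dot_eq0; rewrite dotC dotuJu.
have -> : J m *m nu^T = 0 by apply/dot_eq0; rewrite dotC.
have -> : J nu *m m^T = 0 by apply/dot_eq0; rewrite dot_Jl n2 oppr0.
by rewrite !z block_mx0.
Qed.

Lemma normal_orthogonal x : x *m Q^T = 0 <-> dot x m = 0 /\ dot x nu = 0.
Proof.
rewrite /Q tr_col_mx mul_mx_row; split.
  by rewrite -row_mx0 => /eq_row_mx[/dot_eq0 ? /dot_eq0 ?].
by move=> [/dot_eq0 -> /dot_eq0 ->]; rewrite row_mx0.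
Qed.

Lemma hol_proj x : hol M m nu x <-> x *m Pr = x.
Proof.
rewrite (complement_id (Jmx_tr R n) (Jmx_sqr R n) normal_totally_real).
rewrite !normal_orthogonal -JE !dot_Jl /hol /= (tangent_unitP hM Mm hnu).
rewrite /horizontal /W dotNr; split.
  by move=> [[[-> ->] ->] ->]; rewrite oppr0.
move=> [[-> ->]] [/eqP + ->]; rewrite oppr_eq0 => /eqP ->.
by [].
Qed.

Lemma tangent_projE :
  Pr + w^T *m w = 1%:M - (col_mx Q (J m))^T *m col_mx Q (J m).
Proof.
rewrite /complement_proj /Q !mul_col_mx !tr_col_mx !mul_row_col -!JE.
have -> : w^T *m w = (J nu)^T *m J nu.
  have -> : w^T = - (J nu)^T by rewrite /W linearN.
  by rewrite mulNmx mulmxN opprK.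
by rewrite !opprD !addrA subrK.
Qed.

Lemma tangent_proj x : tangent M m x <-> x *m (Pr + w^T *m w) = x.
Proof.
have [[n1 n2] nn _] := hnu.
rewrite tangent_projE mulmxBr mulmx1 (tangent_unitP hM Mm hnu) /horizontal.
set Q' := col_mx _ _.
have QQ : Q' *m Q'^T = 1%:M.
  rewrite /Q' tr_col_mx mul_col_row normal_totally_real.1.
  have -> : J m *m (J m)^T = 1%:M by apply: dot_eq1; rewrite dotJJ.
  have E : J m *m Q^T = 0.
    apply/normal_orthogonal; split; first by rewrite dotC dotuJu.
    by rewrite dotC n2.
  by rewrite E -[Q *m _]trmxK trmx_mul trmxK E trmx0 -scalar_mx_block.
have Q'0 : x *m Q'^T = 0 <-> (dot x m = 0 /\ dot x nu = 0) /\ dot x (J m) = 0.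
  rewrite /Q' tr_col_mx mul_mx_row -normal_orthogonal; split.
    by rewrite -row_mx0 => /eq_row_mx[-> /dot_eq0 ->].
  by move=> [-> /dot_eq0 ->]; rewrite row_mx0.
split=> [[[h1 h2] h3]|].
  by rewrite mulmxA Q'0.2 // mul0mx subr0.
move=> /eqP; rewrite -subr_eq0 addrAC subrr sub0r oppr_eq0 => /eqP.
move=> /(congr1 (mulmxr Q'^T)) /=; rewrite mul0mx -!mulmxA QQ mulmx1.
by move=> /Q'0 [[? ?] ?].
Qed.

Lemma tangent_proj_tr : (Pr + w^T *m w)^T = Pr + w^T *m w.
Proof. by rewrite linearD /= complement_tr trmx_mul trmxK. Qed.

End Projectors.

Section NormalForm.
Variables (R : realType) (n : nat).
Local Notation V := (cspace R n).
Local Notation N := (n.+2 + n.+2)%N.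
Local Notation K := (Jmx R n).
Variables (M : set V) (m nu : V) (A : V -> V -> R).
Hypotheses (hM : hypersurface M) (Mm : M m) (mm : dot m m = 1).
Hypotheses (hnu : unit_normal M m nu) (hA : second_fundamental_form M m nu A).
Hypothesis (hS : stark M).
Local Notation Q := (normal_frame m nu).
Local Notation Pr := (complement_proj K Q).
Local Notation w := (W nu).
Let KT : K^T = - K := Jmx_tr R n.
Let KK : K *m K = - 1%:M := Jmx_sqr R n.
Let tQ := normal_totally_real mm hnu.
Let PrT : Pr^T = Pr := complement_tr K Q.
Let PrPr : Pr *m Pr = Pr := complement_idem KT KK tQ.
Let KPr : K *m Pr = Pr *m K := complement_K Q KT KK.

Lemma WPr : w *m Pr = 0.
Proof.
have QPr : Q *m Pr = 0.
  have [QK QQK] := totally_realK KT KK tQ.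
  by rewrite /complement_proj !mulmxBr mulmx1 !mulmxA tQ.1 mul1mx subrr QQK !mul0mx subr0.
have [_ nP] : m *m Pr = 0 /\ nu *m Pr = 0.
  by apply: eq_col_mx; rewrite -mul_col_mx QPr col_mx0.
by rewrite /W mulNmx JE -mulmxA KPr mulmxA nP mul0mx oppr0.
Qed.

Lemma WW : w *m w^T = 1%:M.
Proof. by have [_ nn _] := hnu; apply: dot_eq1; rewrite dotNl dotNr opprK dotJJ. Qed.

Lemma PrW : Pr *m w^T = 0.
Proof. by rewrite -PrT -trmx_mul WPr trmx0. Qed.

Lemma trace_hol : \tr Pr = (n.*2)%:R.
Proof.
rewrite (trace_complement KT KK tQ) /=.
by apply/eqP; rewrite subr_eq -natrD eqr_nat; apply/eqP; lia.
Qed.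

Variable H : 'M[R]_N.
Hypotheses (HT : H^T = H)
  (AH : forall X Y, tangent M m X -> tangent M m Y -> A X Y = (X *m H *m Y^T) 0 0).
Local Notation At := (Pr *m H *m Pr).
Local Notation b := (w *m H *m Pr).

(** This is the hypothesis on the restriction of the second fundamental form to
    the holomorphic distribution, whose operator is Pr H Pr. *)
Lemma hol_form_J : Pr *m K *m H *m (Pr *m K)^T = - At.
Proof.
have stark2 := hS.2 m nu A Mm mm hnu hA.
have holP x := hol_proj hM Mm mm hnu x.
apply: bilinear_ext => x y.
have hx : hol M m nu (x *m Pr) by apply/holP; rewrite -mulmxA PrPr.
have hy : hol M m nu (y *m Pr) by apply/holP; rewrite -mulmxA PrPr.
have hol_J z : hol M m nu z -> hol M m nu (J z).
  by move=> /holP zP; apply/holP; rewrite JE -mulmxA KPr mulmxA zP.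
have := stark2 _ _ hx hy; rewrite !AH; [|exact: hx.1|exact: hy.1|
  exact: (hol_J _ hx).1|exact: (hol_J _ hy).1].
rewrite !JE => AK.
have -> : x *m (Pr *m K *m H *m (Pr *m K)^T) *m y^T =
    (x *m Pr *m K) *m H *m (y *m Pr *m K)^T by rewrite !trmx_mul !mulmxA.
rewrite AK mulmxN mulNmx [RHS]mxE; congr (- _).
by rewrite trmx_mul PrT !mulmxA.
Qed.

Lemma hol_form_anticomm : At *m K = - (K *m At).
Proof.
have E2 : K *m At *m K = At.
  apply: oppr_inj; rewrite -hol_form_J trmx_mul PrT KT !mulNmx !mulmxN.
  by rewrite -KPr !mulmxA -(mulmxA _ K Pr) KPr !mulmxA.
by rewrite -{2}E2 !mulmxA KK !mulNmx mul1mx opprK.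
Qed.

(** The restriction of A to the holomorphic distribution is conjugate under J to
    its opposite, so its characteristic polynomial is even and its elementary
    symmetric functions of odd degree vanish.  The austere condition thus says
    that those of A vanish, that is, the characteristic polynomial of A is odd.
    In the basis obtained by adjoining W to a basis of the holomorphic
    distribution, the matrix of A is bordered. *)
Lemma hol_form_moments :
  w *m H *m w^T = 0 /\ forall j, odd j -> b *m At ^+ j *m b^T = 0.
Proof.
have holP x := hol_proj hM Mm mm hnu x.
have tanP x := tangent_proj hM Mm mm hnu x.
have AHh X Y : hol M m nu X -> hol M m nu Y -> A X Y = (X *m H *m Y^T) 0 0.
  by move=> hX hY; rewrite AH //; [exact: hX.1|exact: hY.1].
set PT := Pr + w^T *m w in tanP.
have PTT : PT^T = PT by exact: tangent_proj_tr.
have PTPT : PT *m PT = PT.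
  have D P (D : 'M[R]_N) : P *m P = P -> P *m D = 0 -> D *m P = 0 -> D *m D = D ->
      (P + D) *m (P + D) = P + D.
    by move=> PP PD DP DD; rewrite mulmxDl !mulmxDr PP PD DP DD addr0 add0r.
  apply: D => //; first by rewrite mulmxA PrW mul0mx.
    by rewrite -mulmxA WPr mulmx0.
  by rewrite mulmxA -(mulmxA _ w) WW mulmx1.
have aust := hS.1 m nu A Mm mm hnu hA.
have [_ [_ [p [e [_ [eh _ _]]]]]] := aust 0%N isT.
have [EE EP] := basis_frame PrT holP PrPr eh.
move: (\matrix_i e i) EE EP => E EE EP {e eh}.
have pE : p = n.*2.
  by apply/eqP; rewrite -(eqr_nat R) -trace_hol -EP mxtrace_mulC EE mxtrace1.
have EPr : E *m Pr = E by rewrite -EP mulmxA EE mul1mx.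
have PrEt : Pr *m E^T = E^T by rewrite -{2}EPr trmx_mul PrT.
have Ew : E *m w^T = 0 by rewrite -EPr -mulmxA PrW mulmx0.
have ETET := frame_col_mx EE WW Ew.
have ETP : (col_mx E w)^T *m col_mx E w = PT.
  by rewrite tr_col_mx mul_row_col EP.
pose B := E *m H *m E^T.
have BE : B = E *m At *m E^T.
  by rewrite !mulmxA EPr -(mulmxA _ Pr) PrEt.
(* the bases E and E K give opposite matrices *)
have chiB : parity false (char_poly B).
  apply: even_char_poly.
  - by move=> x /eqP; rewrite mulrn_eq0 => /eqP.
  - by rewrite pE odd_double.
  - have EKEK : (E *m K) *m (E *m K)^T = 1%:M.
      by rewrite trmx_mul KT mulNmx mulmxN mulmxA -(mulmxA E) KK mulmxN mulmx1 mulNmx EE opprK.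
    have EKP : (E *m K)^T *m (E *m K) = Pr.
      rewrite trmx_mul KT !mulNmx -mulmxA (mulmxA E^T) EP mulmxA KPr -mulmxA KK.
      by rewrite mulmxN mulmx1 opprK.
    have [|| _ chi] := frame_change H EE EKEK.
    + by exists (E *m K *m E^T); rewrite -(mulmxA (E *m K)) EP -EKP mulmxA EKEK mul1mx.
    + by exists (E *m (E *m K)^T); rewrite -(mulmxA E) EKP -EP mulmxA EE mul1mx.
    rewrite {1}/B chi; congr char_poly.
    rewrite BE -mulNmx -mulmxN -hol_form_J.
    have -> : E *m K = E *m (Pr *m K) by rewrite mulmxA EPr.
    by rewrite trmx_mul !mulmxA.
have chiT : parity true (char_poly (col_mx E w *m H *m (col_mx E w)^T)).
  move=> i; rewrite eqb_id => i_even.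
  have iE : i = (i./2).*2 by rewrite -[LHS]odd_double_half (negbTE i_even).
  have [iN|Ni] := leqP i n.*2; last first.
    apply: nth_default; rewrite size_char_poly pE addn1.
    lia.
  (* the coefficient of degree i is the symmetric function of degree
     2 n + 1 - i = 2 j + 1 *)
  pose j := (n - i./2)%N.
  have [x [xT xh]] := aust j (leq_subr _ _).
  have jE : (2 * j%:Z + 1 = j.*2.+1%:Z)%R by lia.
  have ji : (p + 1 - j.*2.+1 = i)%N by rewrite /j pE; lia.
  rewrite jE in xT.
  have jp : (j.*2.+1 <= p + 1)%N by rewrite pE /j; lia.
  have := form_elem_sym_coef PTT tanP PTPT AH ETET ETP xT isT jp; rewrite ji.
  suff -> : x = 0 by move=> /esym/eqP; rewrite mulf_eq0 signr_eq0 => /eqP.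
  have [j0|j0] := posnP j.
    by move: xh => [? [? [s [_ _ ->]]]]; rewrite j0 /elem_sym.
  have jE' : (2 * j%:Z - 1 = j.*2.-1%:Z)%R by lia.
  rewrite jE' in xh.
  rewrite (form_elem_sym_coef PrT holP PrPr AHh EE EP xh); [|lia|rewrite pE /j; lia].
  by rewrite chiB ?mulr0 // pE; lia.
pose be := w *m H *m E^T.
have blk : col_mx E w *m H *m (col_mx E w)^T =
    block_mx B be^T be ((w *m H *m w^T) 0 0)%:M.
  rewrite mul_col_mx tr_col_mx mul_col_row -mx11_scalar.
  by rewrite /be !trmx_mul trmxK HT !mulmxA.
rewrite blk in chiT.
have p_even : ~~ odd p by rewrite pE odd_double.
have [w0 mom] := odd_moments_eq0 p_even chiB chiT.
split; first by rewrite [LHS]mx11_scalar w0 raddf0.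
have bE : b = be *m E by rewrite -EP !mulmxA.
have AtE : At = E^T *m B *m E by rewrite -EP !mulmxA.
clear blk chiB chiT BE; clearbody B be.
have pw j : b *m At ^+ j = be *m B ^+ j *m E.
  elim: j => [|j IH]; first by rewrite !expr0 !mulmx1.
  rewrite !expmxS (mulmxA b (At ^+ j) At) IH AtE !mulmxA.
  by rewrite -(mulmxA _ E E^T) EE mulmx1.
move=> j /mom; rewrite pw {1}bE trmx_mul !mulmxA -(mulmxA _ E) EE mulmx1 => mj.
by rewrite [LHS]mx11_scalar mj raddf0.
Qed.

Lemma form_on_hol p q (X : 'M[R]_(p, N)) (Y : 'M[R]_(q, N)) :
  X *m Pr = X -> Y *m Pr = Y -> X *m H *m Y^T = X *m At *m Y^T.
Proof.
move=> XP YP; have PY : Pr *m Y^T = Y^T by rewrite -{2}YP trmx_mul PrT.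
by rewrite !mulmxA XP -(mulmxA _ Pr) PY.
Qed.

Lemma phi_hol x : x *m Pr = x -> phi nu x = x *m K.
Proof.
move=> /(hol_proj hM Mm mm hnu)[_]; rewrite /phi /W dotNr => /eqP.
by rewrite oppr_eq0 dot_Jl => /eqP ->; rewrite oppr0 scale0r subr0.
Qed.

(** The standard basis arises when the cyclic space and its image under J
    fill the holomorphic distribution; then d = 0 is impossible, since it would
    make the cyclic space trivial. *)
Lemma normal_form : (0 < n)%N ->
  (exists (e : 'I_(n + n + 1) -> V) (S : 'M[R]_n) (d : 'cV[R]_n),
       [/\ standard_basis M m nu e, S^T = S, d != 0 &
           matrix_in A e = standard_mx S d]) \/
    (exists (k l : nat) (e : 'I_((k + k) + (l + l + 1)) -> V)
            (P Q : 'M[R]_k) (S : 'M[R]_l) (d : 'cV[R]_l),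
       [/\ (0 < k)%N /\ (k + l = n)%N, split_basis M m nu e,
           [/\ P^T = P, Q^T = Q & S^T = S] &
           matrix_in A e = split_mx P Q S d]).
Proof.
move=> n_gt0; have [wHw mom] := hol_form_moments.
have tanP x := tangent_proj hM Mm mm hnu x.
have AtT : At^T = At by rewrite !trmx_mul PrT HT mulmxA.
have AtPr : At *m Pr = At by rewrite -mulmxA PrPr.
have bPr : b *m Pr = b by rewrite -mulmxA PrPr.
have [k [l [G [F [[tG tF GF GKF] [GPr FPr PrE] [FAF GAF GAKF] [bE bF]]]]]] :=
  split_frames KT KK AtT hol_form_anticomm mom PrT PrPr KPr AtPr bPr.
have AtK := hol_form_anticomm.
move: At AtT AtPr AtK mom FAF GAF GAKF form_on_hol => B BT BPr BK _ FBF GBF GBKF form_on_hol.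
have KB : K *m B = - (B *m K) by rewrite BK opprK.
have trK p q (X : 'M[R]_(p, N)) (Y : 'M[R]_(q, N)) : X *m (Y *m K)^T = - (X *m K *m Y^T).
  by rewrite trmx_mul KT mulNmx mulmxN mulmxA.
have PK p (X : 'M[R]_(p, N)) : X *m Pr = X -> X *m K *m Pr = X *m K.
  by move=> XP; rewrite -mulmxA KPr mulmxA XP.
have GKPr := PK _ _ GPr; have FKPr := PK _ _ FPr.
have [GKGK GGK] := totally_realK KT KK tG; have [FKFK FFK] := totally_realK KT KK tF.
have Fw p (X : 'M[R]_(p, N)) : X *m Pr = X -> X *m w^T = 0.
  by move=> <-; rewrite -mulmxA PrW mulmx0.
have XHw p (X : 'M[R]_(p, N)) : X *m Pr = X -> X *m H *m w^T = X *m b^T.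
  by move=> XP; rewrite !trmx_mul PrT HT !mulmxA XP.
have KBK p q (X : 'M[R]_(p, N)) (Y : 'M[R]_(q, N)) :
    X *m K *m B *m (Y *m K)^T = - (X *m B *m Y^T).
  rewrite trK -(mulmxA X) KB mulmxN !mulNmx -!mulmxA (mulmxA K K) KK mulNmx mul1mx.
  by rewrite !mulmxN opprK.
have KBX p q (X : 'M[R]_(p, N)) (Y : 'M[R]_(q, N)) :
    X *m K *m B *m Y^T = X *m B *m (Y *m K)^T.
  by rewrite trK -(mulmxA X) KB mulmxN mulNmx !mulmxA.
have symB p q (X : 'M[R]_(p, N)) (Y : 'M[R]_(q, N)) :
    (X *m B *m Y^T)^T = Y *m B *m X^T by rewrite !trmx_mul trmxK BT mulmxA.
have kl : (k + l)%N = n.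
  have := trace_hol; rewrite PrE !mxtraceD !trace_frame ?tF.1 ?tG.1 //.
  by rewrite -!natrD => /eqP; rewrite eqr_nat => /eqP; lia.
(* the block of the vectors F, F K and W: A vanishes on the span of F because
   B maps it to that of F K, and b is in the span of F *)
pose S := F *m B *m (F *m K)^T.
pose d := F *m b^T.
have ST : S^T = S by rewrite /S symB KBX.
pose EF := col_mx (col_mx F (F *m K)) w.
have EFEF : EF *m EF^T = 1%:M.
  apply: frame_col_mx; [|exact: WW|].
    by apply: frame_col_mx => //; exact: tF.1.
  by rewrite mul_col_mx !Fw // col_mx0.
have EFH : EF *m H *m EF^T = standard_mx S d.
  have FwE : F *m K *m H *m w^T = 0.
    have bT : b^T = F^T *m d by rewrite {1}bE (trmx_mul (b *m F^T)) (trmx_mul b) trmxK.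
    by rewrite XHw // bT mulmxA tF.2 mul0mx.
  have wE p (X : 'M[R]_(p, N)) : w *m H *m X^T = (X *m H *m w^T)^T.
    by rewrite !trmx_mul trmxK HT mulmxA.
  rewrite /EF !block_form /standard_mx (form_on_hol _ _ F F) // (form_on_hol _ _ F (F *m K)) //.
  rewrite (form_on_hol _ _ (F *m K) F) // (form_on_hol _ _ (F *m K) (F *m K)) // FBF KBK FBF oppr0 KBX -/S.
  rewrite wHw mul_col_mx mul_col_mx FwE XHw // -/d.
  rewrite wE mul_col_mx mul_col_mx FwE XHw // -/d tr_col_mx trmx0.
  by [].
have hol_row p (X : 'M[R]_(p, N)) i : X *m Pr = X -> row i X *m Pr = row i X.
  by move=> XP; rewrite -row_mul XP.
have [k0|k0] := posnP k.
- left; move: kl; rewrite k0 add0n => ln.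
  subst l k; exists (fun i => row i EF), S, d.
  have EFP : EF^T *m EF = Pr + w^T *m w.
    rewrite /EF !tr_col_mx !mul_row_col PrE (flatmx0 G) mulmx0 mul0mx mulmx0.
    by rewrite !add0r.
  have EFb := frame_basis tanP EFEF EFP.
  split=> //.
  + split=> //.
      by rewrite /EF rowKd row_id.
    move=> j; rewrite /EF !rowKu rowKd phi_hol; first by rewrite row_mul.
    exact: hol_row.
  + apply/eqP => d0; move: n_gt0; rewrite bF //.
    by apply: trmx_inj; rewrite (trmx_mul b) trmxK -/d d0 trmx0.
  + by rewrite (matrix_in_row AH) //; case: EFb.
right.
(* the remaining block, orthogonal to the first one for both the metric and A *)
pose P := G *m B *m G^T; pose Qm := G *m B *m (G *m K)^T.
pose GG := col_mx G (G *m K).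
have GGb p (C : 'M[R]_(N, p)) : G *m C = 0 -> G *m K *m C = 0 -> GG *m C = 0.
  by move=> h1 h2; rewrite /GG mul_col_mx h1 h2 col_mx0.
have GGGG : GG *m GG^T = 1%:M by apply: frame_col_mx => //; exact: tG.1.
have row0b p q r (C : 'M[R]_(r, N)) (X : 'M[R]_(p, N)) (Y : 'M[R]_(q, N)) :
    C *m X^T = 0 -> C *m Y^T = 0 -> C *m (col_mx X Y)^T = 0.
  by move=> h1 h2; rewrite tr_col_mx mul_mx_row h1 h2 row_mx0.
have GGEF : GG *m EF^T = 0.
  apply: (row0b); first apply: (row0b); apply: GGb.
  - exact: GF.
  - exact: GKF.
  - by rewrite trK GKF oppr0.
  - by rewrite trK -(mulmxA G) KK mulmxN mulmx1 mulNmx GF !oppr0.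
  - exact: Fw.
  - exact: Fw.
have Gd0 : G *m b^T = 0.
  by rewrite bE (trmx_mul (b *m F^T)) mulmxA GF mul0mx.
have GKd0 : G *m K *m b^T = 0.
  by rewrite bE (trmx_mul (b *m F^T)) mulmxA GKF mul0mx.
have GGH : GG *m H *m EF^T = 0.
  apply: (row0b); first apply: (row0b); rewrite -mulmxA; apply: GGb; rewrite mulmxA.
  - by rewrite form_on_hol.
  - by rewrite form_on_hol // KBX.
  - by rewrite form_on_hol.
  - by rewrite form_on_hol // KBK GBF oppr0.
  - by rewrite XHw.
  - by rewrite XHw.
have EFGG : EF *m H *m GG^T = 0.
  by apply: trmx_inj; rewrite !trmx_mul trmxK HT mulmxA GGH trmx0.
pose E := col_mx GG EF.
have EE : E *m E^T = 1%:M by exact: frame_col_mx.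
have EP : E^T *m E = Pr + w^T *m w.
  by rewrite /E /GG /EF !tr_col_mx !mul_row_col PrE addrA.
have Eb := frame_basis tanP EE EP.
exists k, l, (fun i => row i E), P, Qm, S, d; split=> //.
- split=> //.
  + by rewrite /E /EF !rowKd row_id.
  + move=> j; rewrite /E /GG !rowKu rowKd phi_hol; first by rewrite row_mul.
    exact: hol_row.
  + move=> j; rewrite /E /EF !rowKd !rowKu rowKd phi_hol; first by rewrite row_mul.
    exact: hol_row.
- by split=> //; rewrite /P /Qm symB // KBX.
- rewrite (matrix_in_row AH); last by case: Eb.
  rewrite /E block_form EFH GGH EFGG /GG block_form /split_mx.
  rewrite (form_on_hol _ _ G G) // (form_on_hol _ _ G (G *m K)) //.
  by rewrite (form_on_hol _ _ (G *m K) G) // (form_on_hol _ _ (G *m K) (G *m K)) // KBK KBX.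
Qed.

End NormalForm.

Theorem proposition4 (R : realType) (n : nat) (M : set (cspace R n)) :
  (1 <= n)%N -> hypersurface M -> stark M ->
  forall (m nu : cspace R n) (A : cspace R n -> cspace R n -> R),
    M m -> dot m m = 1 -> unit_normal M m nu ->
    second_fundamental_form M m nu A ->
    (exists (e : 'I_(n + n + 1) -> cspace R n) (S : 'M[R]_n) (d : 'cV[R]_n),
       [/\ standard_basis M m nu e, S^T = S, d != 0 &
           matrix_in A e = standard_mx S d]) \/
    (exists (k l : nat) (e : 'I_((k + k) + (l + l + 1)) -> cspace R n)
            (P Q : 'M[R]_k) (S : 'M[R]_l) (d : 'cV[R]_l),
       [/\ (0 < k)%N /\ (k + l = n)%N, split_basis M m nu e,
           [/\ P^T = P, Q^T = Q & S^T = S] &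
           matrix_in A e = split_mx P Q S d]).
Proof.
move=> n_gt0 hM hS m nu A Mm mm hnu hA.
have [H HT AH] := sff_matrix hM Mm mm hnu hA.
exact: (normal_form hM Mm mm hnu hA hS HT AH n_gt0).
Qed.
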